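(* Let $n\ge 4$. Any conformally flat hypersurface $M$ ($\dim M=n$) in the Euclidean space $\mathbb{R}^{n+1}$, which is free of umbilical points, locally lies on a canal hypersurface.
   Context: A point of a hypersurface is umbilical if the shape operator there is a multiple of the identity. A hypersurface is conformally flat if its induced Riemannian metric is (locally) conformally flat. A canal hypersurface in $\mathbb{R}^{n+1}$ is a hypersurface which is a one-parameter family of $(n-1)$-dimensional spheres $S^{n-1}(s)$ (spherical generators) such that the normals to the hypersurface at the points of any fixed generator pass through a fixed point; equivalently, it is the envelope of a one-parameter family of hyperspheres.
   Formalization: Hyperplanes count as limiting hyperspheres in the family enveloped by a canal hypersurface (normals along such a generator are then parallel); with genuine hyperspheres only, the claim fails for a cylinder over a plane curve of nonzero curvature. *)

(* Defs.v *)
From HB Require Import structures.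
From mathcomp Require Import all_boot all_order all_algebra.
From mathcomp Require Import all_classical all_reals all_analysis.
Set Implicit Arguments.
Unset Strict Implicit.
Unset Printing Implicit Defensive.
Import Order.TTheory GRing.Theory Num.Theory numFieldNormedType.Exports.
Local Open Scope classical_set_scope.
Local Open Scope ring_scope.

(* Class C^oo on an open set: every iterated directional derivative
   'D_v1 ('D_v2 (... f)) is differentiable (hence continuous). *)
Definition smooth_on (R : realType) (V W : normedModType R)
    (U : set V) (f : V -> W) : Prop :=
  forall (vs : seq V) (u : V), U u ->
    differentiable (foldr (fun v g => 'D_v g) f vs) u.

(* The norm of 'rV[R]_n in the library is the sup norm (same topology); the
   Euclidean structure is carried by this dot product. *)
Definition dot (R : realType) (n : nat) (x y : 'rV[R]_n) : R :=
  \sum_(k < n) x 0 k * y 0 k.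

(* Row vectors: 'd F u v = v *m jacobian F u, so row i of the Jacobian is the
   i-th partial derivative of F. *)
Definition immersion_on (R : realType) (n m : nat)
    (U : set 'rV[R]_n) (F : 'rV[R]_n -> 'rV[R]_m) : Prop :=
  smooth_on U F /\ forall u, U u -> row_free (jacobian F u).

(* x restricted to U is the inverse of a chart of M (a homeomorphism of the open
   set U onto an open subset of M) in which f is a smooth immersion. *)
Definition local_param (R : realType) (n m : nat) (M : topologicalType)
    (f : M -> 'rV[R]_m) (U : set 'rV[R]_n) (x : 'rV[R]_n -> M) : Prop :=
  [/\ open U,
      {in U &, injective x},
      {in U, continuous x},
      forall V : set 'rV[R]_n, V `<=` U -> open V -> open (x @` V)
    & immersion_on U (f \o x)].

(* (Immersed, in particular embedded) smooth hypersurface of R^(n+1).  Changes of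
   parametrization x^-1 \o y are automatically smooth, because f \o x and f \o y
   are immersions, so the local parametrizations form a smooth atlas of M. *)
Definition hypersurface (R : realType) (n : nat) (M : topologicalType)
    (f : M -> 'rV[R]_n.+1) : Prop :=
  forall p : M, exists U : set 'rV[R]_n, exists x : 'rV[R]_n -> M,
    local_param f U x /\ (x @` U) p.

(* Matrix of the induced metric in the coordinates of the parametrization. *)
Definition metric (R : realType) (n m : nat) (F : 'rV[R]_n -> 'rV[R]_m)
    (u : 'rV[R]_n) : 'M[R]_n :=
  \matrix_(i, j) dot (row i (jacobian F u)) (row j (jacobian F u)).

(* Around every point there are coordinates of M in which the induced metric is a
   positive smooth multiple of the flat metric. *)
Definition conformally_flat (R : realType) (n : nat) (M : topologicalType)
    (f : M -> 'rV[R]_n.+1) : Prop :=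
  forall p : M, exists U : set 'rV[R]_n, exists x : 'rV[R]_n -> M,
  exists rho : 'rV[R]_n -> R,
    [/\ local_param f U x, (x @` U) p, smooth_on U rho
      & forall u, U u -> 0 < rho u /\ metric (f \o x) u = (rho u)%:M].

(* Generalized cross product of the n rows of J: its dot product with w is, up to
   a sign, the determinant of the rows of J together with w. *)
Definition cross_product (R : realType) (n : nat) (J : 'M[R]_(n, n.+1)) :
    'rV[R]_n.+1 :=
  \row_k ((-1) ^+ k * \det (col' k J)).

Definition unit_normal (R : realType) (n : nat)
    (F : 'rV[R]_n -> 'rV[R]_n.+1) (u : 'rV[R]_n) : 'rV[R]_n.+1 :=
  let N := cross_product (jacobian F u) in (Num.sqrt (dot N N))^-1 *: N.

(* The shape operator A is given by d(nu) = - dF \o A with nu the unit normal.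
   With row vectors its matrix S satisfies
     jacobian nu = - S *m jacobian F,
   whence the formula, metric F being jacobian F *m (jacobian F)^T.  The choice
   of the orientation of nu only affects the sign of S. *)
Definition shape_operator (R : realType) (n : nat)
    (F : 'rV[R]_n -> 'rV[R]_n.+1) (u : 'rV[R]_n) : 'M[R]_n :=
  - (jacobian (unit_normal F) u *m (jacobian F u)^T *m invmx (metric F u)).

Definition umbilical (R : realType) (n : nat) (M : topologicalType)
    (f : M -> 'rV[R]_n.+1) (p : M) : Prop :=
  exists U : set 'rV[R]_n, exists x : 'rV[R]_n -> M, exists u : 'rV[R]_n,
    [/\ local_param f U x, U u, x u = p
      & exists lambda : R, shape_operator (f \o x) u = lambda%:M].

(* Equation  a |x|^2 - 2 <b, x> + c = 0  of a hypersphere, normalized by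
   <b, b> - a c = 1.  If a <> 0 it is the hypersphere with centre b / a and radius
   1 / |a|.  If a = 0 it is a hyperplane with unit normal b, that is, the limiting
   case of a hypersphere with centre at infinity. *)
Definition hypersphere_eq (R : realType) (m : nat) (a : R) (b : 'rV[R]_m) (c : R)
    (x : 'rV[R]_m) : R :=
  a * dot x x - 2 * dot b x + c.

(* Smooth one-parameter family of hyperspheres over an open interval I.  The
   inequality says that the hyperspheres of parameter s and its derivative
     a' |x|^2 - 2 <b', x> + c' = 0
   meet transversally in a real (n-1)-dimensional sphere, which is the spherical
   generator of parameter s of the envelope (an (n-1)-plane in degenerate cases).
   For centres m(s) and radii r(s) it reads |m'|^2 > r'^2. *)
Definition hypersphere_family (R : realType) (m : nat) (I : set R)
    (a : R -> R) (b : R -> 'rV[R]_m) (c : R -> R) : Prop :=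
  [/\ open I /\ is_interval I,
      [/\ smooth_on I a, smooth_on I b & smooth_on I c],
      forall s, I s -> dot (b s) (b s) - a s * c s = 1
    & forall s, I s -> 0 < dot ('D_1 b s) ('D_1 b s) - 'D_1 a s * 'D_1 c s].

Definition envelope (R : realType) (m : nat) (I : set R)
    (Phi : R -> 'rV[R]_m -> R) : set 'rV[R]_m :=
  [set x | exists s : R,
     [/\ I s, Phi s x = 0 & 'D_1 (fun t : R => Phi t x) s = 0]].

(* Canal hypersurfaces, as envelopes of one-parameter families of hyperspheres.
   Along the generator of parameter s the envelope is tangent to the hypersphere
   of parameter s, so that its normals there pass through the centre of that
   hypersphere (are parallel if the hypersphere degenerates to a hyperplane).
   Hyperplanes cannot be excluded: a cylinder over a plane curve of nonzero
   curvature is flat and free of umbilical points, but all its hyperspheres are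
   hyperplanes; and for the (conformally flat, umbilic-free) torus of revolution
   they become hyperplanes at isolated parameters. *)
Definition canal_hypersurface (R : realType) (n : nat) (C : set 'rV[R]_n.+1) :
    Prop :=
  exists (I : set R) (a : R -> R) (b : R -> 'rV[R]_n.+1) (c : R -> R),
    hypersphere_family I a b c /\
    C = envelope I (fun s => hypersphere_eq (a s) (b s) (c s)).

(* Main.v *)
Require Import Defs.
From mathcomp Require Import all_boot all_order all_algebra.
From mathcomp Require Import all_classical all_reals all_analysis.
From mathcomp Require Import ring lra.
Set Implicit Arguments.
Unset Strict Implicit.
Unset Printing Implicit Defensive.
Import Order.TTheory GRing.Theory Num.Theory numFieldNormedType.Exports.
Local Open Scope classical_set_scope.
Local Open Scope ring_scope.

(** Around a point take a chart [F] in which the induced metric is [rho] times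
    the identity, and let [h] be its second fundamental form.

    In such coordinates the Christoffel symbols only involve the differential
    of [rho], so that the Gauss equation says that the curvature-like tensor
    [h i j * h k l - h i l * h j k] is the Kulkarni-Nomizu product of the
    identity with some bilinear form ([gauss_equation]); this is the vanishing
    of the Weyl tensor.  With four different indices at hand, this algebraic
    condition forces [h] to be a multiple [lam] of the identity plus a matrix of
    rank one ([pivot_rank_one]).  At a point that is not umbilical, an
    orthonormal frame can be chosen in which some off-diagonal entry [h a b] is
    nonzero ([off_diagonal_frame]); dividing by this pivot, [lam] and the rank
    one term are rational functions of the entries of [h], hence smooth nearby.

    In terms of the principal curvature [kap = lam / rho], of multiplicity
    [n - 1], and of the unit normal [nu], this reads
    [d nu + kap * d F = p * w] for a linear form [p] and a vector field [w]
    without zeros ([weingarten]).  The exterior derivative of this identity is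
    the Codazzi equation, and it gives that [d kap] is a multiple of [p], the
    kernel of [p] having dimension at least two ([derive_curvature]).
    Therefore the curvature sphere, which touches the hypersurface at [F u] and
    has curvature [kap u], that is, the sphere with coefficients
    [kap], [nu + kap * F], [kap * |F|^2 + 2 * <nu, F>], has partial derivatives
    which are all proportional to [p]: it moves with one degree of freedom.

    It remains to see that the curvature spheres along a segment
    [u0 + t * e a] transversal to the kernel of [p] are already all the
    curvature spheres near [u0].  Functions whose differentials are proportional
    to that of a function [s] are constant on the level sets of [s] near [u0],
    and each of these level sets meets the segment ([level_transport]).  This is
    applied to the equation [Psi] of the curvature sphere at a fixed point
    [F u], and to the slope of [Psi] with respect to [s]
    ([proportional_slope]): both vanish at [u], since the sphere touches the
    hypersurface there, hence also at the parameter of the segment on the same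
    level, which says that [F u] lies on the envelope of the family
    ([canal_of_sphere_pencil]).  The condition that consecutive spheres meet
    transversally holds because the Lorentzian square of the derivative of the
    family is [|w|^2]. *)

(** * Calculus of smooth functions *)

(** Finite differentiability classes: the closure properties of [smooth_on]
    are proved by induction on [k], a rule such as the product rule expressing
    the derivatives of order [k + 1] through functions of class [k]. *)
Definition diff_class (R : realType) (V W : normedModType R) (k : nat)
    (U : set V) (f : V -> W) : Prop :=
  forall (vs : seq V) (u : V), (size vs <= k)%N -> U u ->
    differentiable (foldr (fun v g => 'D_v g) f vs) u.

Section DiffClass.
Variables (R : realType) (V : normedModType R) (U : set V).
Hypothesis oU : open U.

Lemma smoothP (W : normedModType R) (f : V -> W) :
  smooth_on U f <-> forall k, diff_class k U f.
Proof.
split=> [sf k vs u _|cf vs u]; first exact: sf.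
exact: cf (leqnn _).
Qed.

Lemma smooth_differentiable (W : normedModType R) (f : V -> W) u :
  smooth_on U f -> U u -> differentiable f u.
Proof. by move=> /(_ [::] u); apply. Qed.

Lemma smooth_derive (W : normedModType R) (f : V -> W) v :
  smooth_on U f -> smooth_on U ('D_v f).
Proof. by move=> sf vs u Uu; rewrite -foldr_rcons; exact: sf. Qed.

Lemma near_open (P : V -> Prop) u :
  (forall w, U w -> P w) -> U u -> \forall w \near u, P w.
Proof. by move=> HP Uu; apply: filterS (open_nbhs_nbhs (conj oU Uu)). Qed.

Lemma derive_eq_on (W : normedModType R) (f g : V -> W) v u :
  (forall w, U w -> f w = g w) -> U u -> 'D_v f u = 'D_v g u.
Proof. by move=> fg Uu; apply: near_eq_derive; exact: near_open. Qed.

Lemma differentiable_eq_on (W : normedModType R) (f g : V -> W) u :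
  (forall w, U w -> f w = g w) -> U u ->
  differentiable f u -> differentiable g u.
Proof.
move=> fg Uu /diff_locallyP[cf /eqaddoP of_].
have og : g \o shift u = cst (g u) + 'd f u +o_ 0 id.
  apply/eqaddoP => e e0.
  have Us : \forall h \near (0 : V), U (h + u).
    have : nbhs u U by exact: open_nbhs_nbhs.
    by move=> /nbhs0P; apply: filterS => h; rewrite addrC.
  apply: filterS2 Us (of_ e e0) => h /fg eh.
  by rewrite !fctE /= eh (fg u Uu).
have dg := diff_unique cf og.
by apply/diff_locallyP; rewrite dg.
Qed.

Lemma diff_classS (W : normedModType R) k (f : V -> W) :
  diff_class k.+1 U f <->
  (forall u, U u -> differentiable f u) /\
  (forall v, diff_class k U ('D_v f)).
Proof.
split=> [cf|[cf0 cf] vs u].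
  split=> [u Uu|v vs u svs Uu]; first exact: (cf [::]).
  by rewrite -foldr_rcons; apply: cf => //; rewrite size_rcons.
elim/last_ind: vs => [|vs v _] svs Uu; first exact: cf0.
by rewrite foldr_rcons; apply: cf => //; rewrite size_rcons in svs.
Qed.

Lemma diff_class0 (W : normedModType R) (f : V -> W) :
  diff_class 0 U f <-> forall u, U u -> differentiable f u.
Proof.
split=> [cf u Uu|cf vs u svs Uu]; first exact: (cf [::]).
by case: vs svs => // _; exact: cf.
Qed.

Lemma diff_classW (W : normedModType R) k (f : V -> W) :
  diff_class k.+1 U f -> diff_class k U f.
Proof. by move=> cf vs u svs; apply: cf; exact: leqW. Qed.

Lemma diff_class_eq (W : normedModType R) k (f g : V -> W) :
  (forall u, U u -> f u = g u) -> diff_class k U f -> diff_class k U g.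
Proof.
elim: k f g => [|k IHk] f g fg.
  move=> /diff_class0 df; apply/diff_class0 => u Uu.
  exact: (differentiable_eq_on fg Uu (df u Uu)).
move=> /diff_classS[df cf]; apply/diff_classS; split=> [u Uu|v].
  exact: (differentiable_eq_on fg Uu (df u Uu)).
by apply: IHk (cf v) => u; exact: derive_eq_on.
Qed.

Lemma diff_class_cst (W : normedModType R) k (a : W) :
  diff_class k U (fun=> a).
Proof.
elim: k a => [|k IHk] a; first by apply/diff_class0 => u _; exact: differentiable_cst.
apply/diff_classS; split=> [u _|v]; first exact: differentiable_cst.
by apply: diff_class_eq (IHk 0) => u _; rewrite derive_cst.
Qed.

Lemma diff_classD (W : normedModType R) k (f g : V -> W) :
  diff_class k U f -> diff_class k U g -> diff_class k U (fun u => f u + g u).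
Proof.
elim: k f g => [|k IHk] f g.
  move=> /diff_class0 df /diff_class0 dg; apply/diff_class0 => u Uu.
  by apply: differentiableD; [exact: df|exact: dg].
move=> /diff_classS[df cf] /diff_classS[dg cg].
apply/diff_classS; split=> [u Uu|v].
  by apply: differentiableD; [exact: df|exact: dg].
apply: diff_class_eq (IHk _ _ (cf v) (cg v)) => u Uu.
by rewrite -deriveD//; apply: diff_derivable; [exact: df|exact: dg].
Qed.

Lemma diff_classM k (f g : V -> R) :
  diff_class k U f -> diff_class k U g -> diff_class k U (fun u => f u * g u).
Proof.
elim: k f g => [|k IHk] f g.
  move=> /diff_class0 df /diff_class0 dg; apply/diff_class0 => u Uu.
  by apply: differentiableM; [exact: df|exact: dg].
move=> Cf Cg; have /diff_classS[df cf] := Cf; have /diff_classS[dg cg] := Cg.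
apply/diff_classS; split=> [u Uu|v].
  by apply: differentiableM; [exact: df|exact: dg].
have CD := diff_classD (IHk _ _ (diff_classW Cf) (cg v))
                      (IHk _ _ (diff_classW Cg) (cf v)).
apply: diff_class_eq CD => u Uu.
by rewrite -[RHS]/(derive (f * g) u v) deriveM//; apply: diff_derivable;
  [exact: df|exact: dg].
Qed.

Lemma diff_classV k (f : V -> R) : (forall u, U u -> f u != 0) ->
  diff_class k U f -> diff_class k U (fun u => (f u)^-1).
Proof.
move=> f0; elim: k => [|k IHk].
  move=> /diff_class0 df; apply/diff_class0 => u Uu.
  by apply: differentiableV; [exact: df|exact: f0].
move=> Cf; have /diff_classS[df cf] := Cf.
apply/diff_classS; split=> [u Uu|v].
  by apply: differentiableV; [exact: df|exact: f0].
have CV := IHk (diff_classW Cf).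
have CD := diff_classM (diff_class_cst (-1 : R))
  (diff_classM (diff_classM CV CV) (cf v)).
apply: diff_class_eq CD => u Uu.
rewrite deriveV ?f0//; last by apply: diff_derivable; exact: df.
by rewrite mulN1r /GRing.scale /= mulNr expr2 invfM.
Qed.

Lemma derive_sqrt_comp (f : V -> R) v u : differentiable f u -> 0 < f u ->
  differentiable (fun w => Num.sqrt (f w)) u /\
  'D_v (fun w => Num.sqrt (f w)) u = 'D_v f u * (2 * Num.sqrt (f u))^-1.
Proof.
move=> df f0.
have ds : differentiable (@Num.sqrt R) (f u).
  by apply/derivable1_diffP; have [] := is_derive1_sqrt f0.
have dc : differentiable (@Num.sqrt R \o f) u by exact: differentiable_comp.
split=> //; rewrite -[LHS]/(derive (Num.sqrt \o f) u v) deriveE// diff_comp//=.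
rewrite -(deriveE v df) -[X in 'd _ _ X]mulr1 [LHS]linearZ -(deriveE (1 : R) ds).
by rewrite derive_sqrt.
Qed.

Lemma diff_class_sqrt k (f : V -> R) : (forall u, U u -> 0 < f u) ->
  diff_class k U f -> diff_class k U (fun u => Num.sqrt (f u)).
Proof.
move=> f0; elim: k => [|k IHk].
  move=> /diff_class0 df; apply/diff_class0 => u Uu.
  by have [] := derive_sqrt_comp 0 (df u Uu) (f0 u Uu).
move=> Cf; have /diff_classS[df cf] := Cf.
apply/diff_classS; split=> [u Uu|v].
  by have [] := derive_sqrt_comp 0 (df u Uu) (f0 u Uu).
have CV : diff_class k U (fun u => (2 * Num.sqrt (f u))^-1).
  apply: diff_classV => [u Uu|].
    by rewrite mulf_neq0// gt_eqF// sqrtr_gt0 f0.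
  exact: diff_classM (diff_class_cst (2 : R)) (IHk (diff_classW Cf)).
apply: diff_class_eq (diff_classM (cf v) CV) => u Uu.
by have [_ ->] := derive_sqrt_comp v (df u Uu) (f0 u Uu).
Qed.

Lemma smooth_eq (W : normedModType R) (f g : V -> W) :
  (forall u, U u -> f u = g u) -> smooth_on U f -> smooth_on U g.
Proof.
by move=> fg /smoothP cf; apply/smoothP => k; exact: diff_class_eq (cf k).
Qed.

Lemma smooth_cst (W : normedModType R) (a : W) : smooth_on U (fun=> a).
Proof. by apply/smoothP => k; exact: diff_class_cst. Qed.

Lemma smoothD (W : normedModType R) (f g : V -> W) :
  smooth_on U f -> smooth_on U g -> smooth_on U (fun u => f u + g u).
Proof.
by move=> /smoothP cf /smoothP cg; apply/smoothP => k; exact: diff_classD.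
Qed.

Lemma smoothM (f g : V -> R) :
  smooth_on U f -> smooth_on U g -> smooth_on U (fun u => f u * g u).
Proof.
by move=> /smoothP cf /smoothP cg; apply/smoothP => k; exact: diff_classM.
Qed.

Lemma smoothV (f : V -> R) : (forall u, U u -> f u != 0) ->
  smooth_on U f -> smooth_on U (fun u => (f u)^-1).
Proof. by move=> f0 /smoothP cf; apply/smoothP => k; exact: diff_classV. Qed.

Lemma smooth_sqrt (f : V -> R) : (forall u, U u -> 0 < f u) ->
  smooth_on U f -> smooth_on U (fun u => Num.sqrt (f u)).
Proof. by move=> f0 /smoothP cf; apply/smoothP => k; exact: diff_class_sqrt. Qed.

Lemma smoothN (f : V -> R) : smooth_on U f -> smooth_on U (fun u => - f u).
Proof.
move=> sf; have := smoothM (smooth_cst (-1 : R)) sf.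
by apply: smooth_eq => u _; rewrite mulN1r.
Qed.

Lemma smoothB (f g : V -> R) :
  smooth_on U f -> smooth_on U g -> smooth_on U (fun u => f u - g u).
Proof. by move=> sf sg; exact: smoothD sf (smoothN sg). Qed.

Lemma smooth_sum (I : Type) (r : seq I) (P : pred I) (f : I -> V -> R) :
  (forall i, smooth_on U (f i)) -> smooth_on U (fun u => \sum_(i <- r | P i) f i u).
Proof.
move=> sf; elim: r => [|i r IHr].
  by apply: smooth_eq (smooth_cst (0 : R)) => u _; rewrite big_nil.
have [Pi|nPi] := boolP (P i).
  by apply: smooth_eq (smoothD (sf i) IHr) => u _; rewrite big_cons Pi.
by apply: smooth_eq IHr => u _; rewrite big_cons (negPf nPi).
Qed.

Lemma smooth_prod (I : Type) (r : seq I) (f : I -> V -> R) :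
  (forall i, smooth_on U (f i)) -> smooth_on U (fun u => \prod_(i <- r) f i u).
Proof.
move=> sf; elim: r => [|i r IHr].
  by apply: smooth_eq (smooth_cst (1 : R)) => u _; rewrite big_nil.
by apply: smooth_eq (smoothM (sf i) IHr) => u _; rewrite big_cons.
Qed.

Lemma smooth_det n (A : V -> 'M[R]_n) :
  (forall i j, smooth_on U (fun u => A u i j)) -> smooth_on U (fun u => \det (A u)).
Proof.
move=> sA; apply: smooth_sum => s; apply: smoothM; first exact: smooth_cst.
by apply: smooth_prod.
Qed.

End DiffClass.

Section RowValued.
Variables (R : realType) (V : normedModType R).

Lemma differentiable_entry m (F : V -> 'rV[R]_m) j u :
  differentiable F u -> differentiable (fun w => F w 0 j) u.
Proof.
move=> dF; apply: (@differentiable_comp _ _ _ _ F (fun x => x 0 j)) => //.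
exact: differentiable_coord.
Qed.

Lemma derive_entry m (F : V -> 'rV[R]_m) j u v : differentiable F u ->
  ('D_v F u) 0 j = 'D_v (fun w => F w 0 j) u.
Proof. by move=> /(@diff_derivable _ _ _ _ _ v)/derive_mx ->; rewrite mxE. Qed.

Lemma differentiable_row m (F : V -> 'rV[R]_m) u :
  (forall j, differentiable (fun w => F w 0 j) u) -> differentiable F u.
Proof.
move=> dF; have -> : F = \sum_(j < m) (fun w => F w 0 j *: delta_mx 0 j).
  by apply/funext => w; rewrite fct_sumE -row_sum_delta.
apply: differentiable_sum => j; exact: differentiableZl.
Qed.

Lemma derive_fun_add (W : normedModType R) (f g : V -> W) u v :
  differentiable f u -> differentiable g u ->
  'D_v (fun w => f w + g w) u = 'D_v f u + 'D_v g u.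
Proof. by move=> df dg; rewrite -deriveD//; exact: diff_derivable. Qed.

Lemma derive_fun_opp (W : normedModType R) (f : V -> W) u v :
  differentiable f u -> 'D_v (fun w => - f w) u = - 'D_v f u.
Proof. by move=> df; rewrite -deriveN//; exact: diff_derivable. Qed.

Lemma derive_fun_mul (f g : V -> R) u v :
  differentiable f u -> differentiable g u ->
  'D_v (fun w => f w * g w) u = 'D_v f u * g u + f u * 'D_v g u.
Proof.
move=> df dg; rewrite -[LHS]/(derive (f * g) u v) deriveM ; [|exact: diff_derivable..].
by rewrite addrC; congr (_ + _); exact: mulrC.
Qed.

Lemma differentiable_fun_sum m (f : 'I_m -> V -> R) u :
  (forall j, differentiable (f j) u) ->
  differentiable (fun w => \sum_j f j w) u.
Proof.
move=> df; have -> : (fun w => \sum_j f j w) = \sum_j f j.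
  by apply/funext => w; rewrite fct_sumE.
exact: differentiable_sum.
Qed.

Lemma derive_fun_sum m (f : 'I_m -> V -> R) u v :
  (forall j, differentiable (f j) u) ->
  'D_v (fun w => \sum_j f j w) u = \sum_j 'D_v (f j) u.
Proof.
move=> df; have -> : (fun w => \sum_j f j w) = \sum_j f j.
  by apply/funext => w; rewrite fct_sumE.
by rewrite derive_sum// => j; exact: diff_derivable.
Qed.

Lemma differentiable_dot m (A B : V -> 'rV[R]_m) u :
  differentiable A u -> differentiable B u ->
  differentiable (fun w => dot (A w) (B w)) u.
Proof.
move=> dA dB; apply: differentiable_fun_sum => j.
by apply: differentiableM; exact: differentiable_entry.
Qed.

Lemma derive_dot m (A B : V -> 'rV[R]_m) u v :
  differentiable A u -> differentiable B u ->
  'D_v (fun w => dot (A w) (B w)) u =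
    dot ('D_v A u) (B u) + dot (A u) ('D_v B u).
Proof.
move=> dA dB; rewrite derive_fun_sum => [|j]; last first.
  by apply: differentiableM; exact: differentiable_entry.
rewrite -big_split; apply: eq_bigr => j _ /=.
by rewrite derive_fun_mul ?derive_entry//; exact: differentiable_entry.
Qed.

Lemma derive_fun_scale m (f : V -> R) (A : V -> 'rV[R]_m) u v :
  differentiable f u -> differentiable A u ->
  differentiable (fun w => f w *: A w) u /\
  'D_v (fun w => f w *: A w) u = 'D_v f u *: A u + f u *: 'D_v A u.
Proof.
move=> df dA; have dfA : differentiable (fun w => f w *: A w) u.
  apply: differentiable_row => j.
  rewrite (_ : (fun w => _) = (fun w => f w * A w 0 j)); last first.
    by apply/funext => w; rewrite mxE.
  by apply: differentiableM => //; exact: differentiable_entry.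
split=> //; apply/rowP => j; rewrite derive_entry//.
rewrite (_ : (fun w => _) = (fun w => f w * A w 0 j)); last first.
  by apply/funext => w; rewrite mxE.
by rewrite derive_fun_mul ?mxE ?derive_entry//; exact: differentiable_entry.
Qed.

Lemma derive_linear_dir (W : normedModType R) (f : V -> W) u c v w :
  differentiable f u -> 'D_(c *: v + w) f u = c *: 'D_v f u + 'D_w f u.
Proof. by move=> df; rewrite !deriveE// linearP. Qed.

Lemma derive_scale_dir (W : normedModType R) (f : V -> W) u c v :
  differentiable f u -> 'D_(c *: v) f u = c *: 'D_v f u.
Proof. by move=> df; rewrite !deriveE// linearZ. Qed.

Section Smooth.
Variable U : set V.
Hypothesis oU : open U.

Lemma diff_class_rowP m k (F : V -> 'rV[R]_m) :
  diff_class k U F <-> forall j, diff_class k U (fun u => F u 0 j).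
Proof.
elim: k F => [|k IHk] F.
  split=> [/diff_class0 dF j|dF]; apply/diff_class0 => u Uu.
    by apply: differentiable_entry; exact: dF.
  by apply: differentiable_row => j; have /diff_class0 := dF j; exact.
split=> [/diff_classS[dF cF] j|cF].
  apply/diff_classS; split=> [u Uu|v]; first by apply: differentiable_entry; exact: dF.
  have /IHk/(_ j) := cF v; apply: diff_class_eq => // u Uu.
  by rewrite derive_entry//; exact: dF.
have dF u : U u -> differentiable F u.
  by move=> Uu; apply: differentiable_row => j; have /diff_classS[+ _] := cF j; exact.
apply/diff_classS; split=> // v; apply/IHk => j.
have /diff_classS[_ /(_ v)] := cF j; apply: diff_class_eq => // u Uu.
by rewrite derive_entry//; exact: dF.
Qed.

Lemma smooth_rowP m (F : V -> 'rV[R]_m) :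
  smooth_on U F <-> forall j, smooth_on U (fun u => F u 0 j).
Proof.
split=> [/smoothP cF j|sF]; apply/smoothP => k; first exact: (diff_class_rowP _ _).1.
by apply/diff_class_rowP => j; have /smoothP := sF j; exact.
Qed.

Lemma smooth_dot m (A B : V -> 'rV[R]_m) :
  smooth_on U A -> smooth_on U B -> smooth_on U (fun u => dot (A u) (B u)).
Proof.
move=> /smooth_rowP sA /smooth_rowP sB; apply: smooth_sum => // j.
exact: smoothM.
Qed.

Lemma smooth_scale m (f : V -> R) (A : V -> 'rV[R]_m) :
  smooth_on U f -> smooth_on U A -> smooth_on U (fun u => f u *: A u).
Proof.
move=> sf /smooth_rowP sA; apply/smooth_rowP => j.
by apply: smooth_eq (smoothM oU sf (sA j)) => // u _; rewrite mxE.
Qed.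

End Smooth.

(** * Symmetry of second derivatives *)

Lemma is_derive_line (W : normedModType R) (f : V -> W) x v (t : R) :
  differentiable f (t *: v + x) ->
  is_derive t (1 : R) (fun s : R => f (s *: v + x)) ('D_v f (t *: v + x)).
Proof.
move=> df; pose l (s : R) := s *: v + x.
have dz : differentiable (fun s : R => s *: v) t by exact: differentiableZl.
have dl : differentiable l t.
  by apply: differentiableD => //; exact: differentiable_cst.
have dlE : 'd l t 1 = v.
  rewrite -[l]/((fun s : R => s *: v) + cst x) diffD//.
  rewrite diff_cst -[LHS]/('d (fun s : R => s *: v) t 1 + 0) addr0 diffZl//.
  by rewrite diff_val scale1r.
have dc : differentiable (f \o l) t by exact: differentiable_comp.
apply: DeriveDef; first exact/diff_derivable.
rewrite -[LHS]/(derive (f \o l) t 1) (deriveE (1 : R) dc) diff_comp//=.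
by rewrite dlE deriveE.
Qed.

Lemma mean_value_line (f : V -> R) x v :
  (forall t : R, 0 <= t <= 1 -> differentiable f (t *: v + x)) ->
  exists2 t : R, 0 <= t <= 1 & f (v + x) - f x = 'D_v f (t *: v + x).
Proof.
move=> df.
have [|t||t] := @MVT R (fun s => f (s *: v + x)) (fun s => 'D_v f (s *: v + x)) 0 1.
- by [].
- rewrite in_itv /= => /andP[t0 t1]; apply: is_derive_line; apply: df.
  by rewrite !ltW.
- apply: derivable_within_continuous => t; rewrite in_itv /= => /df dt.
  by have [] := is_derive_line dt.
rewrite in_itv /= => /andP[t0 t1]; rewrite scale1r scale0r add0r subr0 mulr1 => e.
by exists t; rewrite ?ltW.
Qed.

End RowValued.

Lemma dist_le_halves (R : realType) (e a b c : R) :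
  `|a - c| < e / 2 -> `|b - c| < e / 2 -> `|a - b| <= e.
Proof.
move=> ac; rewrite distrC => cb; rewrite -(subrKA c).
by rewrite (le_trans (ler_normD _ _))// [leRHS]splitr lerD// ltW.
Qed.

Section Schwarz.
Variables (R : realType) (V : normedModType R) (U : set V).
Hypothesis oU : open U.

(** Two applications of the mean value theorem, first along [v] to a difference
    along [w], then along [w] to the derivative along [v].  The left hand side
    is symmetric in [v] and [w]. *)
Lemma second_difference_mean (f : V -> R) u v w : smooth_on U f ->
  (forall s t : R, 0 <= s <= 1 -> 0 <= t <= 1 -> U (s *: v + t *: w + u)) ->
  exists st : R * R, [/\ 0 <= st.1 <= 1, 0 <= st.2 <= 1 &
    f (v + w + u) - f (v + u) - (f (w + u) - f u) =
      'D_w ('D_v f) (st.1 *: v + st.2 *: w + u)].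
Proof.
move=> sf Ust.
have df x : U x -> differentiable f x by exact: smooth_differentiable.
have dvf x : U x -> differentiable ('D_v f) x.
  by apply: smooth_differentiable; exact: smooth_derive.
have dshift x : U (w + x) -> differentiable (fun y => f (w + y)) x.
  move=> Ux; apply: (@differentiable_comp _ _ _ _ (fun y => w + y) f); last exact: df.
  by apply: differentiableD => //; exact: differentiable_cst.
have Dshift x : U (w + x) -> 'D_v (fun y => f (w + y)) x = 'D_v f (w + x).
  move=> Ux; rewrite /derive; set g1 := fun h => _; set g2 := fun h => _.
  by have -> : g1 = g2 by apply/funext => h; rewrite /g1 /g2 /= addrCA.
have U1 s : 0 <= s <= 1 -> U (s *: v + u) /\ U (w + (s *: v + u)).
  have i0 : 0 <= (0 : R) <= 1 by rewrite lexx ler01.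
  have i1 : 0 <= (1 : R) <= 1 by rewrite lexx ler01.
  move=> s01; split; first by have := Ust s 0 s01 i0; rewrite scale0r addr0.
  by have := Ust s 1 s01 i1; rewrite scale1r -addrA addrCA.
have [|s s01] := @mean_value_line R V (fun y => f (w + y) - f y) u v.
  move=> s /U1[Us Us']; apply: differentiableB; [exact: dshift|exact: df].
have [Us Us'] := U1 s s01.
rewrite derive_fun_add; [|exact: dshift|exact/differentiableN/df].
rewrite derive_fun_opp; [|exact: df].
rewrite Dshift// => e.
have [|t t01] := @mean_value_line R V ('D_v f) (s *: v + u) w.
  by move=> t t01; apply: dvf; rewrite addrCA addrA; apply: Ust.
rewrite -e => e'.
exists (s, t); split; [exact: s01|exact: t01|].
rewrite [(s, t).1]/= [(s, t).2]/=.
rewrite (_ : s *: v + t *: w + u = t *: w + (s *: v + u)).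
  by rewrite -e' (addrC v w) -(addrA w v u).
by rewrite addrCA addrA.
Qed.

(** Schwarz: on small parallelograms at [u] the second difference is a value of
    either mixed derivative near [u]; both are continuous. *)
Lemma derive_comm (f : V -> R) u v w : smooth_on U f -> U u ->
  'D_w ('D_v f) u = 'D_v ('D_w f) u.
Proof.
move=> sf Uu.
have cont x y : {for u, continuous ('D_x ('D_y f))}.
  apply: differentiable_continuous; apply: smooth_differentiable Uu.
  by do 2 apply: smooth_derive.
have scaleDD h x y z : U z ->
    'D_(h *: x) ('D_(h *: y) f) z = h * h * 'D_x ('D_y f) z.
  move=> Uz; have dD t : differentiable ('D_t f) z.
    by apply: smooth_differentiable Uz; exact: smooth_derive.
  rewrite (derive_scale_dir h x (dD (h *: y))).
  have -> : 'D_x ('D_(h *: y) f) z = 'D_x (fun q => h * 'D_y f q) z.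
    apply: derive_eq_on Uz => // q Uq.
    exact: derive_scale_dir (smooth_differentiable sf Uq).
  rewrite (derive_fun_mul x (differentiable_cst h z) (dD y)).
  by rewrite derive_cst mul0r add0r -[LHS]/(h * (h * _)) mulrA.
apply/eqP; rewrite -subr_eq0 -normr_le0; apply/ler_addgt0Pr => e e0.
rewrite add0r.
have e20 : 0 < e / 2 by rewrite divr_gt0.
have /nbhs_ballP[d /= d0 Bd] : \forall z \near u,
    [/\ U z, `|'D_w ('D_v f) u - 'D_w ('D_v f) z| < e / 2 &
            `|'D_v ('D_w f) u - 'D_v ('D_w f) z| < e / 2].
  have nU : nbhs u U by exact: open_nbhs_nbhs.
  have /cvgrPdist_lt/(_ _ e20) c1 := cont w v.
  have /cvgrPdist_lt/(_ _ e20) c2 := cont v w.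
  apply: filterS3 nU c1 c2 => z Uz c1z c2z.
  by split; [exact: Uz|exact: c1z|exact: c2z].
have [h h0 hd] : exists2 h, 0 < h & h * (`|v| + `|w|) < d.
  have q0 : 0 < `|v| + `|w| + 1 by rewrite ltr_wpDl// addr_ge0.
  exists (d / (`|v| + `|w| + 1)); first exact: divr_gt0.
  by rewrite mulrAC ltr_pdivrMr// ltr_pM2l// ltrDl.
have inB s t x y : `|x| + `|y| <= `|v| + `|w| ->
    0 <= s <= 1 -> 0 <= t <= 1 -> ball u d (s *: (h *: x) + t *: (h *: y) + u).
  move=> xy /andP[s0 s1] /andP[t0 t1].
  rewrite -ball_normE /= opprD addrCA subrr addr0 normrN.
  rewrite (le_lt_trans (ler_normD _ _))// !normrZ.
  rewrite (ger0_norm s0) (ger0_norm t0) (gtr0_norm h0).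
  apply: le_lt_trans hd; apply: (@le_trans _ _ (h * (`|x| + `|y|))).
    by rewrite mulrDr lerD// ler_piMl// mulr_ge0// ltW.
  by rewrite ler_pM2l.
have [|[s t] /= [s01 t01 E1]] := @second_difference_mean f u (h *: v) (h *: w) sf.
  by move=> s t s01 t01; have [] := Bd _ (inB _ _ _ _ (lexx _) s01 t01).
have wv : `|w| + `|v| <= `|v| + `|w| by rewrite addrC.
have [|[s' t'] /= [s01' t01' E2]] := @second_difference_mean f u (h *: w) (h *: v) sf.
  by move=> s' t' s01' t01'; have [] := Bd _ (inB _ _ _ _ wv s01' t01').
have [Uz az _] := Bd _ (inB _ _ _ _ (lexx _) s01 t01).
have [Uz' _ bz] := Bd _ (inB _ _ _ _ wv s01' t01').
set z := s *: _ + _ + u in E1 Uz az; set z' := s' *: _ + _ + u in E2 Uz' bz.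
have zz' : 'D_w ('D_v f) z = 'D_v ('D_w f) z'.
  have hh : h * h != 0 by rewrite mulf_neq0// gt_eqF.
  have exch (a b c k : R) : a - b - (c - k) = a - c - (b - k) by ring.
  have L1 := etrans (esym (scaleDD h w v z Uz)) (esym E1).
  have L2 := etrans (esym (scaleDD h v w z' Uz')) (esym E2).
  apply: (mulfI hh); apply: (etrans L1); apply: (etrans _ (esym L2)).
  by rewrite exch (addrC (h *: v)).
apply: (dist_le_halves az).
by rewrite zz'; exact: bz.
Qed.

End Schwarz.

Lemma derive_comm_row (R : realType) (V : normedModType R) (U : set V) m
    (F : V -> 'rV[R]_m) u v w : open U -> smooth_on U F -> U u ->
  'D_w ('D_v F) u = 'D_v ('D_w F) u.
Proof.
move=> oU sF Uu; have sFj j := (smooth_rowP oU F).1 sF j.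
have H x y j : ('D_x ('D_y F) u) 0 j = 'D_x ('D_y (fun q => F q 0 j)) u.
  rewrite derive_entry; last first.
    by apply: smooth_differentiable Uu; exact: smooth_derive.
  apply: derive_eq_on Uu => // q Uq; rewrite derive_entry//.
  exact: smooth_differentiable Uq.
apply/rowP => j; apply: (etrans (H w v j)).
have C := derive_comm oU v w (sFj j) Uu.
apply: (etrans C); exact: esym (H v w j).
Qed.

Lemma smooth_line (R : realType) (V : normedModType R) (U : set V)
    (I : set R) (f : V -> R) (e x : V) : open U -> open I ->
  (forall t, I t -> U (t *: e + x)) -> smooth_on U f ->
  smooth_on I (fun t => f (t *: e + x)).
Proof.
move=> oU oI IU sf; apply/smoothP => // k.
elim: k f sf => [|k IHk] f sf.
  apply/diff_class0 => t It; have df := smooth_differentiable sf (IU t It).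
  by have [/derivable1_diffP] := is_derive_line df.
apply/diff_classS; split=> [t It|v].
  have df := smooth_differentiable sf (IU t It).
  by have [/derivable1_diffP] := is_derive_line df.
have ce := diff_classM oI (diff_class_cst oI v) (IHk _ (smooth_derive e sf)).
apply: diff_class_eq (ce) => // t It.
have df := smooth_differentiable sf (IU t It).
have [/derivable1_diffP dl <-] := is_derive_line df.
by rewrite -[in RHS](mulr1 v) [RHS]derive_scale_dir.
Qed.

(** * Functions with proportional differentials *)

Section Increments.
Variables (R : realType) (V : normedModType R).

Lemma increment_littleo (f : V -> R) x : differentiable f x ->
  (forall v, 'D_v f x = 0) ->
  forall e : R, 0 < e ->
    exists2 d : R, 0 < d & forall h, `|h| < d -> `|f (h + x) - f x| <= e * `|h|.
Proof.
move=> df Df0 e e0; have /diff_locallyP[_ /eqaddoP/(_ e e0)] := df.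
move=> /nbhs_ballP[d /= d0 Bd]; exists d => // h hd.
have /Bd : ball (0 : V) d h by rewrite -ball_normE /= sub0r normrN.
by rewrite !fctE /= -deriveE// Df0 addr0.
Qed.

Lemma increment_bigO (f : V -> R) x : differentiable f x ->
  exists C d : R, [/\ 0 < C, 0 < d &
    forall h, `|h| < d -> `|f (h + x) - f x| <= C * `|h|].
Proof.
move=> df; have /diff_locallyP[cf /eqaddoP/(_ 1 ltr01)] := df.
move=> /nbhs_ballP[d /= d0 Bd]; have [k k0 kf] := linear_lipschitz cf.
exists (k + 1), d; split=> // [|h hd]; first by rewrite addr_gt0.
have /Bd : ball (0 : V) d h by rewrite -ball_normE /= sub0r normrN.
rewrite !fctE /= mul1r; have := kf h; set D := 'd f x h => kD Bh.
have -> : f (h + x) - f x = (f (h + x) - (f x + D)) + D by ring.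
by rewrite (le_trans (ler_normD _ _))// mulrDl mul1r addrC lerD.
Qed.

(** If [f] has vanishing differential at a point of a path that is only
    Lipschitz there, then [f] along the path, here [h] up to a constant, still
    has derivative [0]; no differentiability of the path is involved. *)
Lemma derive_along_lipschitz (f : V -> R) (P : R -> V) (h : R -> R) r (K d : R) :
  differentiable f (P r) -> (forall v, 'D_v f (P r) = 0) -> 0 < K -> 0 < d ->
  (forall q, `|q - r| < d -> `|P q - P r| <= K * `|q - r|) ->
  (forall q, `|q - r| < d -> h q - h r = f (P q) - f (P r)) ->
  is_derive r (1 : R) h 0.
Proof.
move=> df Df K0 d0 LP hf.
have cv : (fun t : R => t^-1 *: ((h \o shift r) (t *: 1) - h r)) @ 0^' --> (0 : R).
  apply/cvgrPdist_le => e e0.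
  have [d' d'0 Hd'] := increment_littleo df Df (divr_gt0 e0 K0).
  have dd : 0 < Num.min d (d' / K) by rewrite lt_min d0 divr_gt0.
  near=> t.
  have td : `|t| < Num.min d (d' / K) by near: t; apply: dnbhs0_lt.
  have t0 : t != 0 by near: t; exact: nbhs_dnbhs_neq.
  rewrite sub0r normrN normrZ normfV ler_pdivrMl ?normr_gt0//.
  rewrite /= [t%:A]mulr1.
  have := LP (t + r); have := hf (t + r); rewrite addrK => hft LPt.
  move: td; rewrite lt_min => /andP[td1 td2].
  rewrite ltr_pdivlMr// mulrC in td2.
  rewrite (hft td1).
  have := Hd' (P (t + r) - P r) (le_lt_trans (LPt td1) td2); rewrite subrK => H.
  apply: (le_trans H); rewrite (mulrC `|t|).
  have -> : e * `|t| = e / K * (K * `|t|) by rewrite mulrA divfK ?gt_eqF.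
  by rewrite ler_pM2l ?divr_gt0//; exact: LPt.
by apply: DeriveDef; [apply/cvg_ex; exists 0|exact: cvg_lim].
Unshelve. all: by end_near. Qed.

End Increments.

(** Near [u0], a point [u] can be joined to the line through [u0] with direction
    [e] inside its level set for [s]: over [q] in [0, 1] the point of the path is
    [X q (T q)], where [T q] is found on a short interval by the intermediate
    value theorem.  As [s] grows along [e] at a rate at least [m], the path is
    Lipschitz at each [q], so that any [g] with differential proportional to
    that of [s] has derivative [0] along it. *)
Lemma level_transport (R : realType) (V : normedModType R) (U : set V)
    (s : V -> R) (u0 e : V) (eps : R) :
  open U -> U u0 -> smooth_on U s -> 0 < 'D_e s u0 -> 0 < eps ->
  \forall u \near u0, exists2 t : R, `|t| < eps &
    forall g : V -> R, (forall x, U x -> differentiable g x) ->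
      (forall x v, U x -> 'D_v g x * 'D_e s x = 'D_v s x * 'D_e g x) ->
      g u = g (t *: e + u0).
Proof.
move=> oU Uu0 ss; set m2 := 'D_e s u0 => m20 eps0.
have ds x : U x -> differentiable s x by exact: smooth_differentiable.
pose m := m2 / 2; have m0 : 0 < m by rewrite divr_gt0.
have [r r0 Br] : exists2 r : R, 0 < r & forall x, `|x - u0| < r -> U x /\ m < 'D_e s x.
  have cDs : {for u0, continuous ('D_e s)}.
    by apply: differentiable_continuous; apply: smooth_differentiable Uu0; exact: smooth_derive.
  have nU : nbhs u0 U by exact: open_nbhs_nbhs.
  move/cvgrPdist_lt : cDs => /(_ m m0) c1.
  have /nbhs_ballP[r /= r0 Br] : \forall x \near u0, U x /\ `|'D_e s u0 - 'D_e s x| < m.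
    exact: filterI.
  exists r => // x xr; have /Br[Ux Dx] : ball u0 r x by rewrite -ball_normE /= distrC.
  split=> //; move: Dx; rewrite -/m2 ltr_norml => /andP[_]; rewrite /m; lra.
have [d [d0 deps dr]] : exists d : R, [/\ 0 < d, d < eps & d * `|e| < r / 2].
  have q0 : 0 < `|e| + 1 by rewrite ltr_wpDl.
  exists (Num.min (eps / 2) (r / 2 / (`|e| + 1))); split.
  - by rewrite lt_min !divr_gt0.
  - by rewrite gt_min ltr_pdivrMr// ltr_pMr// ltr1n.
  - apply: (@le_lt_trans _ _ (r / 2 / (`|e| + 1) * `|e|)).
      by rewrite ler_wpM2r// ge_min lexx orbT.
    by rewrite mulrAC ltr_pdivrMr// ltr_pM2l ?divr_gt0// ltrDl.
have [r' r'0 Br'] : exists2 r' : R, 0 < r' &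
    forall x, `|x - u0| < r' -> `|s x - s u0| < m * d / 2.
  have md0 : 0 < m * d / 2 by rewrite divr_gt0// mulr_gt0.
  have cs := differentiable_continuous (ds _ Uu0).
  move/cvgrPdist_lt : cs => /(_ _ md0) cs.
  have /nbhs_ballP[r' /= r'0 Br'] : \forall x \near u0, `|s u0 - s x| < m * d / 2.
    exact: cs.
  exists r' => // x xr; have /Br' : ball u0 r' x by rewrite -ball_normE /= distrC.
  by rewrite distrC.
have ri0 : 0 < Num.min r r' / 4 by rewrite divr_gt0// lt_min r0 r'0.
near=> u.
have uu0 : `|u - u0| < Num.min r r' / 4.
  by rewrite distrC; near: u; exact: (@cvgr_dist_lt _ _ _ _ _ id).
move: uu0; set y := u - u0 => yr.
pose X q t := t *: e + (q *: y + u0).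
have qyr q : `|q| <= 2 -> `|q *: y| < r / 2 /\ `|q *: y| < r'.
  move=> q2; have q2y : `|q *: y| <= 2 * `|y| by rewrite normrZ ler_wpM2r.
  have [mr mr'] : Num.min r r' <= r /\ Num.min r r' <= r'.
    by rewrite !ge_min !lexx orbT.
  split; apply: (le_lt_trans q2y); lra.
have XU q t : `|q| <= 2 -> `|t| <= d -> U (X q t) /\ m < 'D_e s (X q t).
  move=> q2 td; apply: Br; rewrite /X addrA addrK (le_lt_trans (ler_normD _ _))//.
  have [qr _] := qyr q q2; rewrite normrZ [r]splitr ltrD// (le_lt_trans _ dr)//.
  by rewrite ler_wpM2r.
(* Monotonicity of [s] along [e], with rate at least [m]. *)
have Inc q t t' : `|q| <= 2 -> `|t| <= d -> `|t'| <= d ->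
    exists2 D, m < D & s (X q t') - s (X q t) = (t' - t) * D.
  move=> q2 td td'.
  have Xc c : c *: ((t' - t) *: e) + X q t = X q (t + c * (t' - t)).
    by rewrite /X addrA scalerA -scalerDl (addrC _ t).
  have cd c : 0 <= c <= 1 -> `|t + c * (t' - t)| <= d.
    move=> /andP[c0 c1]; rewrite (_ : t + c * (t' - t) = (1 - c) * t + c * t'); last by ring.
    rewrite (le_trans (ler_normD _ _))// !normrM (ger0_norm c0) ger0_norm ?subr_ge0//.
    have -> : d = (1 - c) * d + c * d by ring.
    by rewrite lerD// ler_wpM2l// subr_ge0.
  have [|c c01] := @mean_value_line R V s (X q t) ((t' - t) *: e).
    by move=> c c01; rewrite Xc; apply: ds; have [] := XU q _ q2 (cd c c01).
  have [Uc mc] := XU q _ q2 (cd c c01).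
  rewrite Xc (derive_scale_dir _ _ (ds _ Uc)) => Es.
  exists ('D_e s (X q (t + c * (t' - t)))) => //; rewrite -[RHS]Es.
  congr (s _ - _); rewrite -[(t' - t) *: e]scale1r Xc; congr (X q _); ring.
have d00 : `|0 : R| <= d by rewrite normr0 ltW.
have dd : `|d| <= d by rewrite gtr0_norm.
have ddN : `|- d| <= d by rewrite normrN gtr0_norm.
have X0 q : X q 0 = q *: y + u0 by rewrite /X scale0r add0r.
have sX0 q : `|q| <= 2 -> `|s (X q 0) - s u0| < m * d / 2.
  by move=> q2; apply: Br'; rewrite X0 addrK; have [] := qyr q q2.
have X10 : X 1 0 = u by rewrite X0 scale1r subrK.
have n12 : `|1 : R| <= 2 by rewrite normr1 ler1n.
have n02 : `|0 : R| <= 2 by rewrite normr0 ler0n.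
have exT q : exists t, `|q| <= 2 -> `|t| <= d /\ s (X q t) = s u.
  have [q2|q2] := boolP (`|q| <= 2); last by exists 0.
  have [D1 mD1 E1] := Inc q 0 d q2 d00 dd.
  have [D2 mD2 E2] := Inc q 0 (- d) q2 d00 ddN.
  have := sX0 q q2; have := sX0 1 n12; rewrite X10 !ltr_norml => /andP[a1 a2] /andP[b1 b2].
  have dD1 : d * m <= d * D1 by rewrite ler_pM2l// ltW.
  have dD2 : d * m <= d * D2 by rewrite ler_pM2l// ltW.
  have [|||t] := @IVT R (fun t => s (X q t)) (- d) d (s u).
  - by rewrite (@le_trans _ _ 0)// ?oppr_le0 ltW.
  - apply: derivable_within_continuous => t; rewrite in_itv /= => td.
    have /ds dt : U (X q t) by have [] := XU q t q2 (_ : `|t| <= d); rewrite ?ler_norml.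
    by have [] := is_derive_line dt.
  - clear - E1 E2 dD1 dD2 a1 a2 b1 b2.
    rewrite ge_min le_max; apply/andP; split; apply/orP; [left|right]; lra.
  - by rewrite in_itv /= -ler_norml => td Et; exists t.
have [T TP] := choice exT.
have T1 : T 1 = 0.
  have [Td Ts] := TP 1 n12.
  have [D mD E] := Inc 1 0 (T 1) n12 d00 Td.
  move: E; rewrite Ts X10 subrr subr0 => /esym/eqP; rewrite mulf_eq0 => /orP[/eqP//|].
  by rewrite gt_eqF// (lt_trans m0).
exists (T 0).
  by have [Td _] := TP 0 n02; exact: le_lt_trans Td deps.
move=> g dg gs; pose P q := X q (T q).
have D0 q : `|q| < 2 -> is_derive q (1 : R) (fun q => g (P q)) 0.
  move=> q2; have q2' := ltW q2; have [Tq Ts] := TP q q2'.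
  have [Uq mq] := XU q (T q) q2' Tq.
  have Dq0 : 'D_e s (P q) != 0 by rewrite gt_eqF// (lt_trans m0).
  (* [g - k * s] has zero differential at [P q], and [s] is constant on the path. *)
  pose k := 'D_e g (P q) / 'D_e s (P q).
  have dk : differentiable (fun x => k * s x) (P q).
    by apply: differentiableM; [exact: differentiable_cst|exact: ds].
  have [C [c [C0 c0 Cc]]] := increment_bigO (ds _ Uq).
  pose K := C * `|y| / m * `|e| + `|y| + 1.
  have K0 : 0 < K.
    by rewrite ltr_wpDl// addr_ge0// mulr_ge0// divr_ge0 ?(ltW m0)// mulr_ge0// ltW.
  have y10 : 0 < `|y| + 1 by rewrite ltr_wpDl.
  have near_q q' : `|q' - q| < Num.min (c / (`|y| + 1)) (2 - `|q|) ->
      `|q'| <= 2 /\ `|(q' - q) *: y| < c.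
    rewrite lt_min => /andP[qc qq]; split.
      by rewrite -(subrK q q') (le_trans (ler_normD _ _))// -lerBrDr ltW.
    rewrite normrZ; apply: (@le_lt_trans _ _ (`|q' - q| * (`|y| + 1))).
      by rewrite ler_wpM2l// lerDl.
    by rewrite -ltr_pdivlMr.
  apply: (@derive_along_lipschitz _ _ (fun x => g x - k * s x) P _ q K
           (Num.min (c / (`|y| + 1)) (2 - `|q|))).
  - exact: differentiableB (dg _ Uq) dk.
  - move=> v; rewrite derive_fun_add; [|exact: dg|exact: differentiableN].
    rewrite derive_fun_opp// derive_fun_mul; [|exact: differentiable_cst|exact: ds].
    have -> : k * 'D_v s (P q) = 'D_v g (P q).
      by rewrite /k mulrAC (mulrC ('D_e g _)) -(gs (P q) v Uq) mulfK.
    by rewrite derive_cst mul0r add0r subrr.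
  - exact: K0.
  - by rewrite lt_min divr_gt0// subr_gt0.
  - move=> q' /near_q[q2'' qc].
    have [Tq' Ts'] := TP q' q2''.
    have [D mD ED] := Inc q' (T q) (T q') q2'' Tq Tq'.
    have XX : X q' (T q) = (q' - q) *: y + X q (T q).
      by rewrite /X [RHS]addrCA [(q' - q) *: y + _]addrA -scalerDl subrK.
    have sC : `|s (X q' (T q)) - s (X q (T q))| <= C * `|(q' - q) *: y|.
      by rewrite XX; exact: Cc.
    have TT : m * `|T q' - T q| <= C * (`|q' - q| * `|y|).
      rewrite -normrZ (le_trans _ sC)//.
      have -> : s (X q' (T q)) - s (X q (T q)) = - ((T q' - T q) * D).
        by rewrite -ED Ts Ts' opprB.
      rewrite normrN normrM mulrC ler_wpM2l//.
      by rewrite gtr0_norm ?ltW// (lt_trans m0).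
    have -> : P q' - P q = (T q' - T q) *: e + (q' - q) *: y.
      rewrite /P /X opprD addrACA -scalerBl; congr (_ + _).
      by rewrite opprD addrACA subrr addr0 -scalerBl.
    rewrite (le_trans (ler_normD _ _))// !normrZ.
    apply: (@le_trans _ _ ((C * `|y| / m * `|e| + `|y|) * `|q' - q|)); last first.
      by rewrite ler_wpM2r// /K lerDl.
    rewrite mulrDl lerD//; last by rewrite mulrC.
    have -> : C * `|y| / m * `|e| * `|q' - q| = C * (`|q' - q| * `|y|) / m * `|e| by ring.
    by rewrite ler_wpM2r// ler_pdivlMr// mulrC.
  - move=> q' /near_q[q2'' _]; have [_ Ts'] := TP q' q2''.
    by rewrite /P Ts Ts'; ring.
have [|q||q _] := @MVT_segment R (fun q => g (P q)) (fun=> 0) 0 1.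
- exact: ler01.
- by rewrite in_itv /= => /andP[q0 q1]; apply: D0; rewrite gtr0_norm// (lt_trans q1) ?ltr1n.
- apply: derivable_within_continuous => q; rewrite in_itv /= => /andP[q0 q1].
  have [] // := D0 q; by rewrite ger0_norm// (le_lt_trans q1) ?ltr1n.
by rewrite mul0r => /eqP; rewrite subr_eq0 /P T1 X10 /X scale0r add0r => /eqP.
Unshelve. all: by end_near. Qed.

(** * The algebra of the Gauss equation *)

Lemma ord_avoid3 n (a b c : 'I_n) : (4 <= n)%N ->
  exists l, [/\ l != a, l != b & l != c].
Proof.
move=> n4; case: (pickP [pred l | [&& l != a, l != b & l != c]]) => [l|none].
  by move=> /and3P[la lb lc]; exists l.
have : (#|[set: 'I_n]%SET| <= #|[set a; b; c]%SET|)%N.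
  apply/subset_leq_card/fintype.subsetP => l _; rewrite !inE.
  by have := none l; rewrite /= => /negbT; rewrite !negb_and !negbK orbA.
rewrite finset.cardsT card_ord => nc.
have : (#|[set a; b; c]%SET| <= 3)%N.
  by rewrite (leq_trans (leq_card_setU _ _).1)// finset.cards1 addn1 ltnS finset.cards2; case: eqP.
by move=> /(leq_trans nc)/(leq_trans n4).
Qed.

(** The hypothesis, evaluated on indices with few coincidences, yields [W1] (four
    distinct indices), [W2] (three) and [W3] (two), where [P] only enters through
    the entry [P j k] and the sum [P i i + P j j].  Comparing different
    completions by a third and a fourth index eliminates [P], and leaves the
    vanishing of the 2 by 2 minors of [h - lam] that contain the pivot
    [h a b]. *)
Lemma pivot_rank_one (K : realFieldType) n (h P : 'I_n -> 'I_n -> K)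
    (a b c : 'I_n) :
  (4 <= n)%N -> (forall i j, h i j = h j i) ->
  (forall i j k l, h i j * h k l - h i l * h j k =
     P i j * (k == l)%:R + (i == j)%:R * P k l
     - P i l * (j == k)%:R - (i == l)%:R * P j k) ->
  a != b -> c != a -> c != b -> h a b != 0 ->
  let lam := h c c - h a c * h b c / h a b in
  forall i j, h a b * (h i j - lam * (i == j)%:R) =
    (h i b - lam * (i == b)%:R) * (h a j - lam * (a == j)%:R).
Proof.
move=> n4 hs KN ab ca cb x0 lam; set x := h a b in x0 lam *.
have W1 i j k l : i != j -> i != k -> i != l -> j != k -> j != l -> k != l ->
    h i j * h k l = h i l * h j k.
  move=> ij ik il jk jl kl; apply/eqP; rewrite -subr_eq0 KN.
  by rewrite (negPf ij) (negPf il) (negPf jk) (negPf kl) !(mulr0, mul0r, subr0, addr0).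
have W2 i j k : j != k -> i != j -> i != k -> h i i * h j k - h i j * h i k = P j k.
  move=> jk ij ik; rewrite [h i j * _]mulrC KN eqxx (negPf jk) (negPf ij) (negPf ik).
  by rewrite !(mulr0, mul0r, subr0, add0r, mul1r).
have W3 i j : i != j -> h i i * h j j - h i j * h i j = P i i + P j j.
  move=> ij; rewrite KN !eqxx (negPf ij).
  by rewrite !(mulr0, mul0r, subr0, mul1r, mulr1).
(* By [W2], [lam * h a b] is [P a b], whatever the index [c]. *)
have Lk k : k != a -> k != b -> h k k * x - h a k * h b k = lam * x.
  move=> ka kb; have := W2 c a b ab ca cb; have := W2 k a b ab ka kb.
  rewrite (hs k a) (hs k b) (hs c a) (hs c b) -/x => -> <-.
  by rewrite /lam mulrBl divfK.
have offb j : j != a -> j != b -> x * h b j = (h b b - lam) * h a j.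
  move=> ja jb; have [l [la lb lj]] := ord_avoid3 a b j n4.
  have E1 : h b b * h a j - x * h b j = h l l * h a j - h a l * h l j.
    rewrite /x (hs a b) (hs a l).
    by rewrite (W2 b a j) ?(W2 l a j) // eq_sym.
  have E2 := Lk l la lb.
  have E3 : x * h l j = h a j * h b l.
    by apply: W1 => //; rewrite eq_sym.
  have e1 := congr1 (fun z => x * z) E1.
  have e2 := congr1 (fun z => h a j * z) E2.
  have e3 := congr1 (fun z => h a l * z) E3.
  by apply: (mulfI x0); rewrite /= in e1 e2 e3; lra.
have offa j : j != a -> j != b -> x * h j a = h j b * (h a a - lam).
  move=> ja jb; have [l [la lb lj]] := ord_avoid3 a b j n4.
  have E1 : h a a * h b j - x * h a j = h l l * h b j - h b l * h l j.
    rewrite /x (hs b l).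
    by rewrite (W2 a b j) ?(W2 l b j) // eq_sym.
  have E2 := Lk l la lb.
  have E3 : x * h l j = h b j * h a l.
    by rewrite /x (hs a b); apply: W1 => //; rewrite eq_sym.
  have e1 := congr1 (fun z => x * z) E1.
  have e2 := congr1 (fun z => h b j * z) E2.
  have e3 := congr1 (fun z => h b l * z) E3.
  rewrite (hs j a) (hs j b); apply: (mulfI x0); rewrite /= in e1 e2 e3; lra.
(* For [g := h - lam], [W3] gives the relation between the principal 2 by 2
   minors [ab + cd = ac + bd] of [g]; all but the first are already known to
   vanish. *)
have diagab : x * x = (h b b - lam) * (h a a - lam).
  have [d [da db dc]] := ord_avoid3 a b c n4.
  have W : h a a * h b b - x * x + (h c c * h d d - h c d * h c d) =
      h a a * h c c - h a c * h a c + (h b b * h d d - h b d * h b d).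
    rewrite !W3 //; first [ring | by rewrite eq_sym].
  have Lc := Lk c ca cb; have Ld := Lk d da db.
  have cd : c != d by rewrite eq_sym.
  have N1 : x * h c d = h a d * h b c.
    by apply: W1 => //; rewrite eq_sym.
  have N2 : x * h c d = h a c * h b d.
    by rewrite (hs c d); apply: W1 => //; rewrite eq_sym.
  have A := offa c ca cb; have B := offb d da db.
  have Kcd : x * x * ((h c c - lam) * (h d d - lam) - h c d * h c d) = 0.
    have e1 := congr1 (fun z => h a d * h b d * z) Lc.
    have e2 := congr1 (fun z => (h c c - lam) * x * z) Ld.
    have e3 := congr1 (fun z => h a c * h b d * z) N1.
    have e4 := congr1 (fun z => x * h c d * z) N2.
    rewrite /= in e1 e2 e3 e4; lra.
  have Kac : x * ((h a a - lam) * (h c c - lam) - h a c * h a c) = 0.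
    have e1 := congr1 (fun z => (h a a - lam) * z) Lc.
    have e2 := congr1 (fun z => h a c * z) A.
    rewrite (hs c a) (hs c b) /= in e1 e2; lra.
  have Kbd : x * ((h b b - lam) * (h d d - lam) - h b d * h b d) = 0.
    have e1 := congr1 (fun z => (h b b - lam) * z) Ld.
    have e2 := congr1 (fun z => h b d * z) B.
    rewrite /= in e1 e2; lra.
  have e1 := congr1 (fun z => x * z) Kac.
  have e2 := congr1 (fun z => x * z) Kbd.
  have e3 := congr1 (fun z => x * x * z) W.
  apply: (mulfI (mulf_neq0 x0 x0)).
  rewrite /= in e1 e2 e3; lra.
move=> i j; have [->|ia] := eqVneq i a.
  by rewrite (negPf ab) mulr0 subr0.
have [->|jb] := eqVneq j b.
  by rewrite (negPf ab) mulr0 subr0 mulrC.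
have [->|ib] := eqVneq i b.
  have [->|ja] := eqVneq j a.
    by rewrite (eq_sym b) (negPf ab) !mulr1 mulr0 subr0 (hs b a) -diagab.
  by rewrite (eq_sym b) (negPf jb) !mulr0 mulr1 !subr0 offb.
have [->|ja] := eqVneq j a.
  by rewrite (negPf ia) !mulr0 mulr1 !subr0 offa.
rewrite !mulr0 !subr0.
have [<-|ij] := eqVneq i j.
  by rewrite mulr1 (hs i b) mulrBr [x * lam]mulrC -(Lk i)//; ring.
by rewrite mulr0 subr0 (hs i b) [RHS]mulrC; apply: W1 => //; rewrite eq_sym.
Qed.

(** * The unit normal *)

Section Dot.
Variables (R : realType) (n : nat).
Implicit Types (x y z : 'rV[R]_n) (c : R).

Lemma dotC x y : dot x y = dot y x.
Proof. by apply: eq_bigr => k _; rewrite mulrC. Qed.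

Lemma dotDl x y z : dot (x + y) z = dot x z + dot y z.
Proof. by rewrite -big_split; apply: eq_bigr => k _; rewrite mxE mulrDl. Qed.

Lemma dotZl c x y : dot (c *: x) y = c * dot x y.
Proof. by rewrite [RHS]big_distrr; apply: eq_bigr => k _; rewrite mxE /= mulrA. Qed.

Lemma dotDr x y z : dot x (y + z) = dot x y + dot x z.
Proof. by rewrite dotC dotDl !(dotC x). Qed.

Lemma dotZr c x y : dot x (c *: y) = c * dot x y.
Proof. by rewrite dotC dotZl (dotC x). Qed.

Lemma dotNl x y : dot (- x) y = - dot x y.
Proof. by rewrite -scaleN1r dotZl mulN1r. Qed.

Lemma dotNr x y : dot x (- y) = - dot x y.
Proof. by rewrite dotC dotNl (dotC x). Qed.

Lemma dot0l x : dot 0 x = 0.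
Proof. by rewrite -(scale0r 0) dotZl mul0r. Qed.

Lemma dot0r x : dot x 0 = 0. Proof. by rewrite dotC dot0l. Qed.

Lemma dot_suml (I : finType) (F : I -> 'rV[R]_n) y :
  dot (\sum_i F i) y = \sum_i dot (F i) y.
Proof.
by apply: (big_morph (fun x => dot x y)) => [x z|]; rewrite ?dotDl ?dot0l.
Qed.

Lemma dot_sumr (I : finType) (F : I -> 'rV[R]_n) y :
  dot y (\sum_i F i) = \sum_i dot y (F i).
Proof. by rewrite dotC dot_suml; apply: eq_bigr => i _; rewrite dotC. Qed.

Lemma dot_mulmx x y : dot x y = (x *m y^T) 0 0.
Proof. by rewrite mxE; apply: eq_bigr => k _; rewrite mxE. Qed.

Lemma dot_ge0 x : 0 <= dot x x.
Proof. by apply: sumr_ge0 => k _; rewrite -expr2 sqr_ge0. Qed.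

Lemma dot_eq0 x : (dot x x == 0) = (x == 0).
Proof.
apply/eqP/eqP => [x0|->]; last exact: dot0l.
apply/rowP => k; rewrite mxE.
have /eqP : x 0 k * x 0 k = 0.
  by apply: (psumr_eq0P _ x0) => // j _; rewrite -expr2 sqr_ge0.
by rewrite mulf_eq0 orbb => /eqP.
Qed.

Lemma dot_gt0 x : x != 0 -> 0 < dot x x.
Proof. by move=> x0; rewrite lt_def dot_eq0 x0 dot_ge0. Qed.

End Dot.

Section CrossProduct.
Variables (R : realType) (n : nat) (J : 'M[R]_(n, n.+1)).

Lemma dot_cross_product (w : 'rV[R]_n.+1) :
  dot w (cross_product J) = \det (col_mx w J : 'M[R]_n.+1).
Proof.
rewrite (expand_det_row _ ord0); apply: eq_bigr => k _.
have -> : (col_mx w J : 'M[R]_n.+1) ord0 k = w 0 k.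
  by rewrite -(col_mxEu w J); congr (col_mx w J _ k); exact: val_inj.
rewrite /cofactor add0n mxE; congr (_ * (_ * \det _)).
apply/matrixP => i j; rewrite [LHS]mxE [RHS]mxE [RHS]mxE.
by rewrite -(col_mxEd w J); congr (col_mx w J _ _); exact: val_inj.
Qed.

Lemma dot_row_cross_product i : dot (row i J) (cross_product J) = 0.
Proof.
rewrite dot_cross_product; apply: (determinant_alternate (i1 := ord0) (i2 := lift ord0 i)).
  exact: neq_lift.
move=> k; transitivity (row i J 0 k).
  by rewrite -(col_mxEu (row i J) J); congr (col_mx _ J _ k); exact: val_inj.
by rewrite mxE -(col_mxEd (row i J) J); congr (col_mx _ J _ k); exact: val_inj.
Qed.

Hypothesis freeJ : row_free J.

Lemma cross_product_neq0 : cross_product J != 0.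
Proof.
apply/eqP => J0.
have [i wJ] : exists i, ~~ (row i (1%:M : 'M[R]_n.+1) <= J)%MS.
  apply/existsP; rewrite -negb_forall; apply/negP => /forallP H.
  have /mxrankS : (1%:M <= J)%MS by apply/row_subP.
  by move/eqP: freeJ => ->; rewrite mxrank1 ltnn.
have := dot_cross_product (row i 1%:M); rewrite J0 dot0r => /esym/eqP/det0P[v v0 v1].
rewrite -[v](hsubmxK (v : 'M[R]_(1, 1 + n))) in v0 v1.
move: v0 v1; set p := lsubmx _; set q := rsubmx _.
move=> v0 vA; have v1 : p *m row i 1%:M + q *m J = 0 by rewrite -mul_row_col; exact: vA.
have [p0|p0] := eqVneq (p 0 0) 0.
  have pE : p = 0 by apply/rowP => k; rewrite ord1 p0 mxE.
  move: v1 v0; rewrite pE mul0mx add0r => /eqP; rewrite mulmx_free_eq0// => /eqP ->.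
  by rewrite row_mx0 eqxx.
case/negP: wJ; apply/submxP; exists (- (p 0 0)^-1 *: q).
rewrite -scalemxAl; move/eqP: v1; rewrite addrC addr_eq0 => /eqP ->.
have -> : p *m row i 1%:M = p 0 0 *: row i 1%:M.
  by rewrite -mul_scalar_mx -mx11_scalar.
by rewrite scalerN scaleNr opprK scalerA mulVf// scale1r.
Qed.

(** The normal completes the rows of [J] to a basis, because the determinant of
    that family is the squared length of the cross product. *)
Lemma cross_product_complete (x : 'rV[R]_n.+1) :
  (forall i, dot x (row i J) = 0) -> dot x (cross_product J) = 0 -> x = 0.
Proof.
move=> xJ xN; pose A : 'M[R]_n.+1 := col_mx (cross_product J) J.
have uA : A^T \in unitmx.
  rewrite unitmx_tr unitmxE unitfE -dot_cross_product dot_eq0.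
  exact: cross_product_neq0.
have xA : x *m A^T = 0.
  apply/rowP => k; rewrite mxE [RHS]mxE.
  have -> : \sum_j x 0 j * A^T j k = dot x (row k A).
    by apply: eq_bigr => j _; rewrite !mxE.
  case: (unliftP ord0 k) => [i|] ->.
    rewrite (_ : row _ A = row i J)//; apply/rowP => j; rewrite mxE [RHS]mxE.
    by rewrite -(col_mxEd (cross_product J) J); congr (col_mx _ J _ j); exact: val_inj.
  rewrite (_ : row _ A = cross_product J)//; apply/rowP => j; rewrite mxE.
  by rewrite -(col_mxEu (cross_product J) J); congr (col_mx _ J _ j); exact: val_inj.
by rewrite -[x]mulmx1 -(mulmxV uA) mulmxA xA mul0mx.
Qed.

End CrossProduct.

Section UnitNormal.
Variables (R : realType) (n : nat) (U : set 'rV[R]_n).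
Variable F : 'rV[R]_n -> 'rV[R]_n.+1.
Hypotheses (oU : open U) (immF : immersion_on U F).

Let sF : smooth_on U F := immF.1.

Lemma immersion_differentiable u : U u -> differentiable F u.
Proof. exact: smooth_differentiable sF. Qed.

Lemma row_jacobian u i : U u -> row i (jacobian F u) = 'D_(delta_mx 0 i) F u.
Proof.
by move=> Uu; rewrite (deriveEjacobian _ (immersion_differentiable Uu)) rowE.
Qed.

Lemma smooth_cross_product : smooth_on U (fun u => cross_product (jacobian F u)).
Proof.
apply/smooth_rowP => // k.
pose A u : 'M[R]_(n, n.+1) := \matrix_(i, j) ('D_(delta_mx 0 i) F u) 0 j.
have sA i j : smooth_on U (fun u => A u i j).
  have /smooth_rowP/(_ j) sD := smooth_derive (delta_mx 0 i) sF.
  by apply: smooth_eq (sD oU) => // u _; rewrite mxE.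
have sdet : smooth_on U (fun u => (-1) ^+ k * \det (col' k (A u))).
  apply: smoothM => //; first exact: smooth_cst.
  apply: smooth_det => // i j; apply: smooth_eq (sA i (lift k j)) => // u _.
  by rewrite [RHS]mxE.
apply: smooth_eq sdet => // u Uu; rewrite mxE; congr (_ * \det (col' k _)).
by apply/matrixP => i j; rewrite mxE -row_jacobian// mxE.
Qed.

Lemma cross_product_gt0 u : U u ->
  0 < dot (cross_product (jacobian F u)) (cross_product (jacobian F u)).
Proof. by move=> Uu; rewrite dot_gt0// cross_product_neq0//; exact: immF.2. Qed.

Lemma smooth_unit_normal : smooth_on U (unit_normal F).
Proof.
have sN := smooth_cross_product; apply: smooth_scale => //.
apply: smoothV => // [u Uu|]; first by rewrite gt_eqF// sqrtr_gt0 cross_product_gt0.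
apply: smooth_sqrt => //; first exact: cross_product_gt0.
exact: smooth_dot.
Qed.

Lemma dot_unit_normal u : U u -> dot (unit_normal F u) (unit_normal F u) = 1.
Proof.
move=> /cross_product_gt0 N0; rewrite /unit_normal dotZl dotZr mulrA -invfM -expr2.
by rewrite sqr_sqrtr ?ltW// mulVf// gt_eqF.
Qed.

Lemma dot_derive_unit_normal u v : U u -> dot ('D_v F u) (unit_normal F u) = 0.
Proof.
move=> Uu; rewrite (deriveEjacobian _ (immersion_differentiable Uu)) /unit_normal.
rewrite dotZr mulmx_sum_row dot_suml big1 ?mulr0// => i _.
by rewrite dotZl dot_row_cross_product mulr0.
Qed.

Lemma tangent_normal_complete u x : U u ->
  (forall v, dot x ('D_v F u) = 0) -> dot x (unit_normal F u) = 0 -> x = 0.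
Proof.
move=> Uu xF; rewrite /unit_normal dotZr => /eqP; rewrite mulf_eq0 => /orP[|/eqP xN].
  by rewrite gt_eqF// invr_gt0 sqrtr_gt0 cross_product_gt0.
apply: (cross_product_complete (immF.2 u Uu)) => // i.
by rewrite row_jacobian.
Qed.

Lemma dot_derive_metric u v w : U u ->
  dot ('D_v F u) ('D_w F u) = (v *m metric F u *m w^T) 0 0.
Proof.
move=> Uu; have dF := immersion_differentiable Uu.
have -> : metric F u = jacobian F u *m (jacobian F u)^T.
  apply/matrixP => i j; rewrite mxE [RHS]mxE; apply: eq_bigr => k _.
  by rewrite !mxE.
by rewrite !deriveEjacobian// dot_mulmx trmx_mul !mulmxA.
Qed.

End UnitNormal.

(** * Orthonormal frames *)

Section Frame.
Variables (R : realType) (n : nat) (e : 'I_n -> 'rV[R]_n).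
Hypothesis on : forall i j, dot (e i) (e j) = (i == j)%:R.

Lemma frame_expansion v : v = \sum_i dot v (e i) *: e i.
Proof.
pose Q : 'M[R]_n := \matrix_i e i.
have Q1 : Q *m Q^T = 1%:M.
  apply/matrixP => i j; rewrite [RHS]mxE -on mxE; apply: eq_bigr => k _.
  by rewrite !mxE.
rewrite -[LHS]mulmx1 -(mulmx1C Q1) mulmxA mulmx_sum_row.
apply: eq_bigr => i _; rewrite rowK; congr (_ *: _).
by rewrite mxE; apply: eq_bigr => k _; rewrite !mxE.
Qed.

Lemma derive_frame_expansion (W : normedModType R) (f : 'rV[R]_n -> W) u v :
  differentiable f u -> 'D_v f u = \sum_i dot v (e i) *: 'D_(e i) f u.
Proof.
move=> df; rewrite deriveE// {1}(frame_expansion v) linear_sum.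
by apply: eq_bigr => i _; rewrite linearZ deriveE.
Qed.

End Frame.

Section OffDiagonalFrame.
Variables (R : realType) (n : nat) (B : 'rV[R]_n -> 'rV[R]_n -> R).
Hypothesis BDl : forall x x' y k, B (k *: x + x') y = k * B x y + B x' y.
Hypothesis BDr : forall x y y' k, B x (k *: y + y') = k * B x y + B x y'.

Lemma dot_delta (i j : 'I_n) :
  dot (delta_mx 0 i) (delta_mx 0 j) = (i == j)%:R :> R.
Proof.
rewrite /dot (bigD1 i)//= big1 ?addr0 => [|k ki]; last first.
  by rewrite !mxE (negPf ki) andbF mul0r.
by rewrite !mxE !eqxx mul1r.
Qed.

(** If [B] is diagonal in the standard basis but not scalar, two diagonal entries
    [B i i] and [B j j] differ.  The reflection along [q := d i - 2 * d j] mixes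
    [d i] and [d j] with the rational coefficients 3/5 and 4/5, which makes
    [12 / 25 * (B i i - B j j)] an off-diagonal entry. *)
Lemma off_diagonal_frame :
  ~ (exists lam, forall i j, B (delta_mx 0 i) (delta_mx 0 j) = lam * (i == j)%:R) ->
  exists (e : 'I_n -> 'rV[R]_n) (a b : 'I_n),
    [/\ forall i j, dot (e i) (e j) = (i == j)%:R, a != b & B (e a) (e b) != 0].
Proof.
move=> nscal; pose d i : 'rV[R]_n := delta_mx 0 i.
have [[i j] /= /andP[ij Bij]|off0] :=
    pickP (fun ij : 'I_n * 'I_n => (ij.1 != ij.2) && (B (d ij.1) (d ij.2) != 0)).
  by exists d, i, j; split=> // k l; exact: dot_delta.
have {}off0 i j : i != j -> B (d i) (d j) = 0.
  by move=> ij; have := off0 (i, j); rewrite /= ij => /negbFE/eqP.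
have [[i j] /= Bij|eqd] :=
    pickP (fun ij : 'I_n * 'I_n => B (d ij.1) (d ij.1) != B (d ij.2) (d ij.2)).
  have ij : i != j by apply: contraNneq Bij => ->.
  have ji : j != i by rewrite eq_sym.
  pose q := d i - 2 *: d j; pose c : R := - (2 / 5).
  have qq : dot q q = 5.
    rewrite /q !(dotDl, dotDr, dotNl, dotNr, dotZl, dotZr) !dot_delta !eqxx.
    by rewrite (negPf ij) (negPf ji) /= mulr1n; ring.
  pose e k := d k + (c * dot (d k) q) *: q; exists e, i, j; split=> // [k l|].
    have isometry (x y z : 'rV[R]_n) : dot z z = 5 ->
        dot (x + (- (2 / 5) * dot x z) *: z) (y + (- (2 / 5) * dot y z) *: z) = dot x y.
      by move=> zz; rewrite !(dotDl, dotDr, dotZl, dotZr) zz (dotC z y); field.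
    by rewrite /e isometry// dot_delta.
  have ei : e i = (4 / 5) *: d j + (3 / 5) *: d i.
    rewrite /e /q dotDr dotNr dotZr !dot_delta eqxx (negPf ij) /c /= mulr1n mulr0n.
    by apply/rowP => s; rewrite !mxE; field.
  have ej : e j = (- (3 / 5)) *: d j + (4 / 5) *: d i.
    rewrite /e /q dotDr dotNr dotZr !dot_delta eqxx (negPf ji) /c /= mulr1n mulr0n.
    by apply/rowP => s; rewrite !mxE; field.
  have B0r x : B x 0 = 0.
    by have := BDr x 0 0 1; rewrite scaler0 addr0 mul1r; lra.
  have B0l x : B 0 x = 0.
    by have := BDl 0 0 x 1; rewrite scaler0 addr0 mul1r; lra.
  have BZl x y k : B (k *: x) y = k * B x y by rewrite -[k *: x]addr0 BDl B0l addr0.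
  have BZr x y k : B x (k *: y) = k * B x y by rewrite -[k *: y]addr0 BDr B0r addr0.
  have -> : B (e i) (e j) = 12 / 25 * (B (d i) (d i) - B (d j) (d j)).
    by rewrite ei ej !(BDl, BDr, BZl, BZr) (off0 i j ij) (off0 j i ji); field.
  by rewrite mulf_neq0// ?subr_eq0// mulf_neq0// ?invr_eq0 pnatr_eq0.
case: nscal; case: (posnP n) => [n0|n0].
  by exists 0 => i; have := ltn_ord i; rewrite {2}n0.
exists (B (d (Ordinal n0)) (d (Ordinal n0))) => i j.
have [<-|ij] := eqVneq i j; last by rewrite mulr0 (off0 _ _ ij).
by have /negbFE/eqP := eqd (i, Ordinal n0); rewrite /= mulr1.
Qed.

End OffDiagonalFrame.

(** * The Gauss equation of a conformal chart *)

Lemma koszul_solve (R : realType) (x y z x' y' z' a b c : R) :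
  x + y = a -> x' + z = b -> y' + z' = c -> x' = x -> y' = y -> z' = z ->
  x = (a + b - c) / 2.
Proof. lra. Qed.

(** The tangential part of the second derivatives of a conformal chart, up to
    the factor [2 * rho], is [T i j] with [t] the differential of [rho]. *)
Lemma dot_conformal_tangent (R : realType) n m (E : 'I_n -> 'rV[R]_m) (r : R)
    (t : 'I_n -> R) i j k l :
  (forall i j, dot (E i) (E j) = r * (i == j)%:R) ->
  let G := \sum_q t q *: E q in
  let T i j := t i *: E j + t j *: E i - (i == j)%:R *: G in
  dot (T i j) (T k l) =
    r * (t i * t k * (j == l)%:R + t i * t l * (j == k)%:R
         + t j * t k * (i == l)%:R + t j * t l * (i == k)%:R
         - 2 * t i * t j * (k == l)%:R - 2 * t k * t l * (i == j)%:R
         + (\sum_q t q * t q) * (i == j)%:R * (k == l)%:R).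
Proof.
move=> EE G T.
have EG q : dot (E q) G = r * t q.
  rewrite dot_sumr (bigD1 q)//= big1 ?addr0 => [|s sq].
    by rewrite dotZr EE eqxx mulr1 mulrC.
  by rewrite dotZr EE eq_sym (negPf sq) !mulr0.
have GG : dot G G = r * \sum_q t q * t q.
  rewrite {1}/G dot_suml big_distrr; apply: eq_bigr => q _ /=.
  by rewrite dotZl EG; ring.
rewrite /T !(dotDl, dotDr, dotNl, dotNr, dotZl, dotZr) !EE !(dotC G) !EG GG.
by rewrite !(eq_sym k) !(eq_sym l); ring.
Qed.

Lemma gauss_solve (R : realType) (x y x' y' a b : R) :
  x + y = a -> x' + y' = b -> x = x' -> y - y' = a - b.
Proof. lra. Qed.

(** The Gauss formula: by the Koszul formula the second derivatives [X i j]
    have tangential part [(2 * r)^-1 *: T i j], whence their scalar products. *)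
Lemma dot_second_derivatives (R : realType) n m (E : 'I_n -> 'rV[R]_m)
    (N : 'rV[R]_m) (X : 'I_n -> 'I_n -> 'rV[R]_m) (r : R) (t : 'I_n -> R) :
  0 < r -> (forall i j, dot (E i) (E j) = r * (i == j)%:R) ->
  (forall i, dot (E i) N = 0) -> dot N N = 1 ->
  (forall x, (forall i, dot x (E i) = 0) -> dot x N = 0 -> x = 0) ->
  (forall i j k, dot (X i j) (E k) =
    ((j == k)%:R * t i + (i == k)%:R * t j - (i == j)%:R * t k) / 2) ->
  forall i j k l, dot (X i j) (X k l) = dot (X i j) N * dot (X k l) N +
    (4 * r)^-1 *
      (t i * t k * (j == l)%:R + t i * t l * (j == k)%:R
       + t j * t k * (i == l)%:R + t j * t l * (i == k)%:R
       - 2 * t i * t j * (k == l)%:R - 2 * t k * t l * (i == j)%:R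
       + (\sum_q t q * t q) * (i == j)%:R * (k == l)%:R).
Proof.
move=> r0 EE EN NN complete koszul i j k l.
pose G := \sum_q t q *: E q.
pose T i j := t i *: E j + t j *: E i - (i == j)%:R *: G.
have EG q : dot G (E q) = r * t q.
  rewrite dot_suml (bigD1 q)//= big1 ?addr0 => [|s sq].
    by rewrite dotZl EE eqxx mulr1 mulrC.
  by rewrite dotZl EE (negPf sq) !mulr0.
have TN a b : dot (T a b) N = 0.
  rewrite /T !(dotDl, dotNl, dotZl) dot_suml big1 => [|q _]; last by rewrite dotZl EN mulr0.
  by rewrite !EN !mulr0 addr0 subr0.
have XE a b : X a b = dot (X a b) N *: N + (2 * r)^-1 *: T a b.
  apply/eqP; rewrite -subr_eq0; apply/eqP; apply: complete => [q|].
    rewrite dotDl dotNl dotDl !dotZl (dotC N) EN mulr0 add0r koszul /T.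
    rewrite !(dotDl, dotNl, dotZl) !EE EG; field; exact: lt0r_neq0.
  by rewrite dotDl dotNl dotDl !dotZl TN NN; ring.
have dotNT p q s A B : dot A N = 0 -> dot B N = 0 ->
    dot (p *: N + s *: A) (q *: N + s *: B) = p * q + s * s * dot A B.
  move=> AN BN; rewrite dotDl !dotDr !dotZl !dotZr NN AN (dotC N) BN; ring.
have TX a b c d : dot (X a b) (X c d) = dot (X a b) N * dot (X c d) N +
    (2 * r)^-1 * (2 * r)^-1 * dot (T a b) (T c d).
  by rewrite {1}(XE a b) {1}(XE c d) dotNT.
rewrite TX (dot_conformal_tangent t i j k l EE); congr (_ + _).
rewrite mulrA; congr (_ * _); field; exact: lt0r_neq0.
Qed.

(** Here [y] and [y'] are the two scalar products of second derivatives given by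
    [dot_second_derivatives], and their difference is computed from the
    derivatives of the Koszul formula, [rr] being the Hessian of [rho]. *)
Lemma gauss_curvature_form (R : realType) n (h rr : 'I_n -> 'I_n -> R)
    (t : 'I_n -> R) (N r y y' : R) (i j k l : 'I_n) :
  0 < r -> h l k = h k l -> (forall i j, rr i j = rr j i) ->
  y = h i j * h l k + (4 * r)^-1 *
      (t i * t l * (j == k)%:R + t i * t k * (j == l)%:R
       + t j * t l * (i == k)%:R + t j * t k * (i == l)%:R
       - 2 * t i * t j * (l == k)%:R - 2 * t l * t k * (i == j)%:R
       + N * (i == j)%:R * (l == k)%:R) ->
  y' = h i l * h j k + (4 * r)^-1 *
      (t i * t j * (l == k)%:R + t i * t k * (l == j)%:R
       + t l * t j * (i == k)%:R + t l * t k * (i == j)%:R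
       - 2 * t i * t l * (j == k)%:R - 2 * t j * t k * (i == l)%:R
       + N * (i == l)%:R * (j == k)%:R) ->
  y - y' =
    ((j == k)%:R * rr l i + (i == k)%:R * rr l j - (i == j)%:R * rr l k) / 2
    - ((l == k)%:R * rr j i + (i == k)%:R * rr j l - (i == l)%:R * rr j k) / 2 ->
  let P i j := - rr i j / 2
    + (4 * r)^-1 * (3 * t i * t j - N / 2 * (i == j)%:R) in
  h i j * h k l - h i l * h j k =
    P i j * (k == l)%:R + (i == j)%:R * P k l
    - P i l * (j == k)%:R - (i == l)%:R * P j k.
Proof.
move=> r0 hC rrC -> -> E P; rewrite /P (eq_sym k l).
rewrite (rrC k l) (rrC i l) (rrC i j) (rrC j l) (eq_sym l j) hC in E *.
set hh1 := h i j * h k l in E *; set hh2 := h i l * h j k in E *.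
set q := (4 * r)^-1 in E *.
have -> : hh1 - hh2 = (hh1 + q * (t i * t l * (j == k)%:R + t i * t k * (j == l)%:R
       + t j * t l * (i == k)%:R + t j * t k * (i == l)%:R
       - 2 * t i * t j * (l == k)%:R - 2 * t l * t k * (i == j)%:R
       + N * (i == j)%:R * (l == k)%:R)
   - (hh2 + q * (t i * t j * (l == k)%:R + t i * t k * (j == l)%:R
       + t l * t j * (i == k)%:R + t l * t k * (i == j)%:R
       - 2 * t i * t l * (j == k)%:R - 2 * t j * t k * (i == l)%:R
       + N * (i == l)%:R * (j == k)%:R)))
   - q * (3 * t i * t l * (j == k)%:R - 3 * t i * t j * (l == k)%:R
       + 3 * t j * t k * (i == l)%:R - 3 * t l * t k * (i == j)%:R
       + N * (i == j)%:R * (l == k)%:R - N * (i == l)%:R * (j == k)%:R) by ring.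
by rewrite E; field.
Qed.

Section ConformalChart.
#[local] Opaque derive dot unit_normal.

Variables (R : realType) (n : nat) (U : set 'rV[R]_n).
Variables (F : 'rV[R]_n -> 'rV[R]_n.+1) (rho : 'rV[R]_n -> R).
Variable e : 'I_n -> 'rV[R]_n.
Hypotheses (oU : open U) (immF : immersion_on U F) (srho : smooth_on U rho).
Hypothesis rho_gt0 : forall u, U u -> 0 < rho u.
Hypothesis metricF : forall u, U u -> metric F u = (rho u)%:M.
Hypothesis on : forall i j, dot (e i) (e j) = (i == j)%:R.

Local Notation D i f := ('D_(e i) f).
Local Notation nu := (unit_normal F).

Let sF : smooth_on U F := immF.1.
Let snu : smooth_on U nu := smooth_unit_normal oU immF.

Definition second_form (i j : 'I_n) (u : 'rV[R]_n) : R := dot (D i (D j F) u) (nu u).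
Local Notation h := second_form.

Lemma smooth_second_form i j : smooth_on U (h i j).
Proof.
by apply: smooth_dot => //; apply: smooth_derive; exact: smooth_derive.
Qed.

Lemma second_formC i j u : U u -> h i j u = h j i u.
Proof.
move=> Uu; have C := derive_comm_row (e j) (e i) oU sF Uu.
exact (f_equal (fun x => dot x (nu u)) C).
Qed.

Lemma dot_frame i j u : U u -> dot (D i F u) (D j F u) = rho u * (i == j)%:R.
Proof.
move=> Uu; rewrite (dot_derive_metric immF)// metricF// mul_mx_scalar -scalemxAl.
by rewrite mxE -dot_mulmx on.
Qed.

Lemma dot_frame_normal i u : U u -> dot (D i F u) (nu u) = 0.
Proof. exact: dot_derive_unit_normal. Qed.

Lemma frame_complete u x : U u ->
  (forall i, dot x (D i F u) = 0) -> dot x (nu u) = 0 -> x = 0.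
Proof.
move=> Uu xF; apply: (tangent_normal_complete immF Uu) => v.
rewrite (derive_frame_expansion on v (smooth_differentiable sF Uu)) dot_sumr.
by rewrite big1// => i _; rewrite dotZr xF mulr0.
Qed.

Lemma dot_derive_normal i j u : U u -> dot (D i nu u) (D j F u) = - h i j u.
Proof.
move=> Uu; have dDF := smooth_differentiable (smooth_derive (e j) sF) Uu.
have dn := smooth_differentiable snu Uu.
have E : D i (fun w => dot (D j F w) (nu w)) u = 0.
  rewrite -(derive_cst (0 : R) u (e i)); apply: (derive_eq_on oU) Uu => w Uw.
  exact: dot_frame_normal.
have := derive_dot (e i) dDF dn; rewrite E => /esym/eqP.
by rewrite addrC addr_eq0 dotC => /eqP.
Qed.

Lemma dot_derive_normal_normal i u : U u -> dot (D i nu u) (nu u) = 0.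
Proof.
move=> Uu; have dn := smooth_differentiable snu Uu.
have : D i (fun w => dot (nu w) (nu w)) u = 0.
  rewrite -(derive_cst (1 : R) u (e i)); apply: (derive_eq_on oU) Uu => w Uw.
  exact: (dot_unit_normal immF Uw).
rewrite (derive_dot _ dn dn) (dotC (nu u)) => /eqP.
by rewrite -mulr2n mulrn_eq0 => /eqP.
Qed.

(** The Koszul formula: the cyclic sums of the derivatives of the metric
    determine the scalar products of second with first derivatives. *)
Lemma christoffel i j k u : U u ->
  dot (D i (D j F) u) (D k F u) =
    ((j == k)%:R * D i rho u + (i == k)%:R * D j rho u - (i == j)%:R * D k rho u) / 2.
Proof.
move=> Uu; have dr := smooth_differentiable srho Uu.
have dD l := smooth_differentiable (smooth_derive (e l) sF) Uu.
have C a b : D a (D b F) u = D b (D a F) u.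
  exact: (derive_comm_row (e b) (e a) oU sF Uu).
have M a b c : dot (D c (D a F) u) (D b F u) + dot (D c (D b F) u) (D a F u) =
    (a == b)%:R * D c rho u.
  transitivity (D c (fun w => dot (D a F w) (D b F w)) u).
    by rewrite (derive_dot _ (dD a) (dD b)) [X in _ = _ + X]dotC.
  have -> : D c (fun w => dot (D a F w) (D b F w)) u =
      D c (fun w => rho w * (a == b)%:R) u.
    by apply: (derive_eq_on oU) Uu => w Uw; exact: dot_frame.
  rewrite (derive_fun_mul _ dr (differentiable_cst _ _)) derive_cst mulr0 addr0.
  exact: mulrC.
have C' a b c : dot (D a (D b F) u) (D c F u) = dot (D b (D a F) u) (D c F u).
  exact (f_equal (fun x => dot x (D c F u)) (C a b)).
by apply: (koszul_solve (M j k i) (M i k j) (M i j k)); exact: C'.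
Qed.

Lemma third_derivativeC i j l u : U u ->
  D l (D i (D j F)) u = D j (D i (D l F)) u.
Proof.
move=> Uu.
have E a b c : D a (D b (D c F)) u = D a (D c (D b F)) u.
  apply: (derive_eq_on oU) Uu => w Uw.
  exact: (derive_comm_row (e c) (e b) oU sF Uw).
have S a b c : D a (D b (D c F)) u = D b (D a (D c F)) u.
  exact: (derive_comm_row (e b) (e a) oU (smooth_derive (e c) sF) Uu).
exact (etrans (S l i j) (etrans (E i l j) (S i j l))).
Qed.

Lemma derive_christoffel i j k l u : U u ->
  dot (D l (D i (D j F)) u) (D k F u) + dot (D i (D j F) u) (D l (D k F) u) =
    ((j == k)%:R * D l (D i rho) u + (i == k)%:R * D l (D j rho) u
     - (i == j)%:R * D l (D k rho) u) / 2.
Proof.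
move=> Uu.
have dr a : differentiable (D a rho) u.
  exact: smooth_differentiable (smooth_derive (e a) srho) Uu.
have dD := smooth_differentiable (smooth_derive (e k) sF) Uu.
have dDD := smooth_differentiable (smooth_derive (e i) (smooth_derive (e j) sF)) Uu.
rewrite -(derive_dot _ dDD dD).
have dm c a : differentiable (fun w => c * D a rho w) u.
  exact: (differentiableM (differentiable_cst c u) (dr a)).
have Dm c a : D l (fun w => c * D a rho w) u = c * D l (D a rho) u.
  rewrite (derive_fun_mul _ (differentiable_cst c u) (dr a)).
  by rewrite derive_cst mul0r add0r.
pose S w := (j == k)%:R * D i rho w + (i == k)%:R * D j rho w
  + - ((i == j)%:R * D k rho w).
have dij := differentiableD (dm (j == k)%:R i) (dm (i == k)%:R j).
have dk := differentiableN (dm (i == j)%:R k).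
have DS : D l S u = (j == k)%:R * D l (D i rho) u + (i == k)%:R * D l (D j rho) u
    - (i == j)%:R * D l (D k rho) u.
  apply: (etrans (derive_fun_add (e l) dij dk)); congr (_ + _).
    apply: (etrans (derive_fun_add (e l) (dm _ i) (dm _ j))).
    by congr (_ + _); exact: Dm.
  by apply: (etrans (derive_fun_opp (e l) (dm _ k))); congr (- _); exact: Dm.
have dS : differentiable S u by exact: (differentiableD dij dk).
transitivity (D l (fun w => S w * 2^-1) u).
  by apply: (derive_eq_on oU) Uu => w Uw; exact: christoffel.
rewrite (derive_fun_mul _ dS (differentiable_cst _ u)) derive_cst mulr0 addr0.
by rewrite DS.
Qed.

(** The third derivatives cancel in the difference of two derivatives of the
    Koszul formula; what remains are products of two second derivatives, whose
    tangential parts only contribute terms with a Kronecker symbol. *)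
Lemma gauss_equation u : U u -> exists P : 'I_n -> 'I_n -> R, forall i j k l,
  h i j u * h k l u - h i l u * h j k u =
    P i j * (k == l)%:R + (i == j)%:R * P k l
    - P i l * (j == k)%:R - (i == l)%:R * P j k.
Proof.
move=> Uu; have r0 := rho_gt0 Uu.
pose t q := D q rho u; pose N := \sum_q t q * t q.
pose rr i j := D i (D j rho) u.
have rrC i j : rr i j = rr j i by exact: (derive_comm oU (e j) (e i) srho Uu).
exists (fun i j => - rr i j / 2 + (4 * rho u)^-1 * (3 * t i * t j - N / 2 * (i == j)%:R)).
move=> i j k l.
have dotDD a b c d : dot (D a (D b F) u) (D c (D d F) u) = h a b u * h c d u +
    (4 * rho u)^-1 *
      (t a * t c * (b == d)%:R + t a * t d * (b == c)%:R
         + t b * t c * (a == d)%:R + t b * t d * (a == c)%:R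
         - 2 * t a * t b * (c == d)%:R - 2 * t c * t d * (a == b)%:R
         + N * (a == b)%:R * (c == d)%:R).
  apply: (dot_second_derivatives (E := fun q => D q F u) (N := nu u)
    (X := fun p q => D p (D q F) u) r0) => [p q|p|||p q s].
  - exact: dot_frame.
  - exact: dot_frame_normal.
  - exact: (dot_unit_normal immF Uu).
  - by move=> x xF xN; exact: (frame_complete Uu xF xN).
  - exact: christoffel.
have E1 := derive_christoffel i j k l Uu.
have E2 := derive_christoffel i l k j Uu.
have E3 := f_equal (fun x => dot x (D k F u)) (third_derivativeC i j l Uu).
have H := @gauss_curvature_form R n (fun i j => h i j u) rr t N (rho u) _ _ i j k l r0
  (second_formC l k Uu) rrC (dotDD i j l k) (dotDD i l j k).
have H' := H (gauss_solve E1 E2 E3).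
exact: H'.
Qed.

End ConformalChart.

(** * The Codazzi equation and the curvature spheres *)

(** Elimination of the derivatives [wi], [wj], [wa] of the field [w] from three
    Codazzi equations, and comparison of the components along the frame. *)
Lemma codazzi_solve (R : realType) m (Fi Fj Fa w wi wj wa : 'rV[R]_m)
    (r q pi pj pa ki kj ka b1 b2 b3 : R) :
  0 < r -> pa = 1 ->
  dot Fi Fi = r -> dot Fj Fj = r -> dot Fa Fa = r ->
  dot Fi Fj = 0 -> dot Fa Fi = 0 -> dot Fa Fj = 0 ->
  dot w Fi = pi * q -> dot w Fj = pj * q -> dot w Fa = pa * q ->
  kj *: Fi - ki *: Fj = pi *: wj - pj *: wi + b1 *: w ->
  kj *: Fa - ka *: Fj = pa *: wj - pj *: wa + b2 *: w ->
  ki *: Fa - ka *: Fi = pa *: wi - pi *: wa + b3 *: w ->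
  kj = pj * ka.
Proof.
move=> r0 -> ii jj aa ij ai aj; rewrite mul1r => wFi wFj wFa E1 E2 E3.
pose b := b1 - pi * b2 + pj * b3; pose mi := ki - pi * ka; pose mj := kj - pj * ka.
have E : mj *: Fi - mi *: Fj - (pi * mj - pj * mi) *: Fa = b *: w.
  apply/rowP => s; have := congr1 (fun x : 'rV_m => x 0 s) E1.
  have := congr1 (fun x : 'rV_m => x 0 s) E2.
  have := congr1 (fun x : 'rV_m => x 0 s) E3.
  rewrite !mxE /mi /mj /b => e3 e2 e1.
  have e2' := congr1 (fun x => pi * x) e2; have e3' := congr1 (fun x => pj * x) e3.
  rewrite /= in e2' e3'; lra.
have Ei := congr1 (fun x => dot x Fi) E; have Ej := congr1 (fun x => dot x Fj) E.
have Ea := congr1 (fun x => dot x Fa) E.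
rewrite /= !(dotDl, dotNl, dotZl) ?(dotC Fj Fi) ?(dotC Fi Fa) ?(dotC Fj Fa)
  ii jj aa ij ai aj wFi wFj wFa ?mulr0 ?subr0 ?add0r in Ei Ej Ea.
have bq : b * q = 0.
  have sq : 0 < 1 + pi * pi + pj * pj by nra.
  apply/eqP; rewrite -(mulIr_eq0 _ (mulIf (lt0r_neq0 sq))); apply/eqP.
  have ei := congr1 (fun x => pi * x) Ei; have ej := congr1 (fun x => pj * x) Ej.
  rewrite /= in ei ej; lra.
have : r * mj = 0.
  have := congr1 (fun x => pi * x) bq; rewrite /=; lra.
by move/eqP; rewrite mulf_eq0 (negPf (lt0r_neq0 r0)) subr_eq0 => /eqP.
Qed.

Lemma antisymmetrize (R : realType) m (x x' y y' z z' w : 'rV[R]_m) (b b' k : R) :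
  x + (y + k *: z) = b *: w + x' -> x + (y' + k *: z) = b' *: w + z' ->
  y - y' = x' - z' + (b - b') *: w.
Proof.
move=> E E'; have {E E'} : x + (y + k *: z) - (x + (y' + k *: z)) =
  b *: w + x' - (b' *: w + z') by rewrite E E'.
move=> E; apply/rowP => s; have := congr1 (fun v : 'rV_m => v 0 s) E.
rewrite !mxE; lra.
Qed.

Section Pivot.
#[local] Opaque derive dot unit_normal second_form.

Variables (R : realType) (n : nat) (U : set 'rV[R]_n).
Variables (F : 'rV[R]_n -> 'rV[R]_n.+1) (rho : 'rV[R]_n -> R).
Variable e : 'I_n -> 'rV[R]_n.
Hypotheses (oU : open U) (immF : immersion_on U F) (srho : smooth_on U rho).
Hypothesis rho_gt0 : forall u, U u -> 0 < rho u.
Hypothesis metricF : forall u, U u -> metric F u = (rho u)%:M.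
Hypothesis on : forall i j, dot (e i) (e j) = (i == j)%:R.
Variables a b c : 'I_n.
Hypotheses (n4 : (4 <= n)%N) (ab : a != b) (ca : c != a) (cb : c != b).
Hypothesis hab : forall u, U u -> second_form F e a b u != 0.

Local Notation D i f := ('D_(e i) f).
Local Notation nu := (unit_normal F).
Local Notation h := (second_form F e).

Let sF : smooth_on U F := immF.1.
Let snu : smooth_on U nu := smooth_unit_normal oU immF.
Let sh i j : smooth_on U (h i j) := smooth_second_form e oU immF i j.

(** The value for which the minor of [h - lam] with rows [a], [c] and columns
    [b], [c] vanishes; it is the eigenvalue of multiplicity [n - 1] of [h]. *)
Definition repeated_eigenvalue (u : 'rV[R]_n) : R := h c c u - h a c u * h b c u / h a b u.
Local Notation lam := repeated_eigenvalue.

(** The eigenvalues of the shape operator are those of [h] over [rho]. *)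
Definition curvature u := lam u / rho u.
Local Notation kap := curvature.

(** The linear form [p]: the column [b] of the rank one matrix [h - lam],
    normalized to have entry 1 at [a]. *)
Definition deviation_ratio i u := (h i b u - lam u * (i == b)%:R) / h a b u.
Local Notation p := deviation_ratio.

(** The vector [w], that is, the value of [d nu + kap * d F] on [e a]. *)
Definition deviation u := D a nu u + kap u *: D a F u.
Local Notation w := deviation.

Lemma smooth_repeated_eigenvalue : smooth_on U lam.
Proof.
apply: smoothB => //; apply: smoothM => //; first exact: smoothM.
exact: smoothV.
Qed.

Lemma smooth_curvature : smooth_on U kap.
Proof.
apply: smoothM => //; first exact: smooth_repeated_eigenvalue.
by apply: smoothV => // u Uu; rewrite gt_eqF ?rho_gt0.
Qed.

Lemma smooth_deviation_ratio i : smooth_on U (p i).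
Proof.
apply: smoothM => //; last exact: smoothV.
apply: smoothB => //; apply: smoothM => //; first exact: smooth_repeated_eigenvalue.
exact: smooth_cst.
Qed.

Lemma smooth_deviation : smooth_on U w.
Proof.
apply: smoothD => //; first exact: smooth_derive.
by apply: smooth_scale => //; [exact: smooth_curvature|exact: smooth_derive].
Qed.

Lemma deviation_ratio_pivot u : U u -> p a u = 1.
Proof. by move=> Uu; rewrite /p (negPf ab) mulr0 subr0 divff// hab. Qed.

Lemma second_form_rank_one i j u : U u ->
  h i j u - lam u * (i == j)%:R = p i u * (h a j u - lam u * (a == j)%:R).
Proof.
move=> Uu; have [P KN] := gauss_equation oU immF srho rho_gt0 metricF on Uu.
have hC k l : h k l u = h l k u by exact: (second_formC e oU immF k l Uu).
have E := @pivot_rank_one R n (fun k l => h k l u) P a b c n4 hC KN ab ca cb (hab Uu) i j.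
apply: (mulfI (hab Uu)); apply: (etrans E).
have alg (x y z : R) : x != 0 -> y * z = x * (y / x * z).
  by move=> x0; rewrite mulrA [x * _]mulrC divfK.
exact: alg (hab Uu).
Qed.

Lemma dot_weingarten i j u : U u ->
  dot (D i nu u + kap u *: D i F u) (D j F u) = - (h i j u - lam u * (i == j)%:R).
Proof.
move=> Uu; have r0 := lt0r_neq0 (rho_gt0 Uu).
have E1 := dot_derive_normal e oU immF i j Uu.
have E2 := dot_frame immF metricF on i j Uu.
rewrite dotDl dotZl; apply: (etrans (f_equal2 (fun x y => x + kap u * y) E1 E2)).
by rewrite /kap mulrA divfK// opprB addrC.
Qed.

Lemma dot_weingarten_normal i u : U u -> dot (D i nu u + kap u *: D i F u) (nu u) = 0.
Proof.
move=> Uu; have E1 := dot_derive_normal_normal e oU immF i Uu.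
have E2 := dot_frame_normal e immF i Uu.
rewrite dotDl dotZl; apply: (etrans (f_equal2 (fun x y => x + kap u * y) E1 E2)).
by rewrite mulr0 addr0.
Qed.

(** The two sides have the same scalar products with the moving frame, by the
    rank one decomposition of the second fundamental form. *)
Lemma weingarten i u : U u -> D i nu u + kap u *: D i F u = p i u *: w u.
Proof.
move=> Uu; apply: subr0_eq; apply: (frame_complete immF on Uu) => [j|].
  rewrite dotDl dotNl dotZl.
  apply: (etrans (f_equal2 (fun x y => x - p i u * y) (dot_weingarten i j Uu)
    (dot_weingarten a j Uu))).
  have alg (x y q : R) : x = q * y -> - x - q * - y = 0.
    by move=> ->; rewrite mulrN subrr.
  exact: alg (second_form_rank_one i j Uu).
rewrite dotDl dotNl dotZl.
apply: (etrans (f_equal2 (fun x y => x - p i u * y) (dot_weingarten_normal i Uu)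
  (dot_weingarten_normal a Uu))).
by rewrite mulr0 subrr.
Qed.

Lemma dot_deviation i u : U u ->
  dot (w u) (D i F u) = p i u * - (h a a u - lam u).
Proof.
move=> Uu; apply: (etrans (dot_weingarten a i Uu)).
have hC : h a i u = h i a u by exact: (second_formC e oU immF a i Uu).
have alg (x x' y y' q : R) : x' = x -> y' = y -> x = q * y -> - x' = q * - y'.
  by move=> -> -> ->; rewrite mulrN.
apply: alg (second_form_rank_one i a Uu); first by rewrite hC eq_sym.
by rewrite eqxx mulr1.
Qed.

(** The component of [w] along [e b] is the pivot, up to sign. *)
Lemma deviation_neq0 u : U u -> w u != 0.
Proof.
move=> Uu; apply/eqP => w0; have := dot_weingarten a b Uu.
rewrite -/(w u) w0 dot0l (negPf ab) mulr0 subr0 => /esym/eqP.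
by rewrite oppr_eq0 (negPf (hab Uu)).
Qed.

(** The exterior derivative of the identity of [weingarten], in which the second
    derivatives of [nu] and [F] cancel by symmetry. *)
Lemma codazzi_pair i j u : U u ->
  D j kap u *: D i F u - D i kap u *: D j F u =
    p i u *: D j w u - p j u *: D i w u + (D j (p i) u - D i (p j) u) *: w u.
Proof.
move=> Uu.
have dk := smooth_differentiable smooth_curvature Uu.
have dw := smooth_differentiable smooth_deviation Uu.
have dp k := smooth_differentiable (smooth_deviation_ratio k) Uu.
have dDF k := smooth_differentiable (smooth_derive (e k) sF) Uu.
have dDn k := smooth_differentiable (smooth_derive (e k) snu) Uu.
have E k l : D l (D k nu) u + (D l kap u *: D k F u + kap u *: D l (D k F) u) =
    D l (p k) u *: w u + p k u *: D l w u.
  have [dkF DkF] := derive_fun_scale (e l) dk (dDF k).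
  have [dpw Dpw] := derive_fun_scale (e l) (dp k) dw.
  have A := etrans (derive_fun_add (e l) (dDn k) dkF) (f_equal (fun x => _ + x) DkF).
  apply: (etrans (esym A)); apply: (etrans _ Dpw).
  by apply: (derive_eq_on oU) Uu => v Uv; exact: weingarten.
have Cn := derive_comm_row (e i) (e j) oU snu Uu.
have CF := derive_comm_row (e i) (e j) oU sF Uu.
have E2 := E j i; move: E2; rewrite -Cn -CF; exact: antisymmetrize (E i j).
Qed.

(** Eliminating the derivatives of [w] from the pairs [(i, j)], [(a, j)] and
    [(a, i)] leaves, up to a multiple of [w], the values of [d kap] on the two
    directions [e j - p j * e a] and [e i - p i * e a] of the kernel of [p], each
    multiplying the derivative of [F] along the other one.  These derivatives
    are independent and orthogonal to [w], so that both values vanish; the third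
    index [i] is available as the kernel is not a line. *)
Lemma derive_curvature j u : U u -> D j kap u = p j u * D a kap u.
Proof.
move=> Uu; have [->|ja] := eqVneq j a; first by rewrite deviation_ratio_pivot// mul1r.
have [i [ia ij _]] := ord_avoid3 a j j n4.
have FF k l := dot_frame immF metricF on k l Uu.
have same k : dot (D k F u) (D k F u) = rho u by rewrite FF eqxx mulr1.
have diff k l : k != l -> dot (D k F u) (D l F u) = 0.
  by move=> kl; rewrite FF (negPf kl) mulr0.
apply: (codazzi_solve (rho_gt0 Uu) (deviation_ratio_pivot Uu) (same i) (same j) (same a)
  (diff i j ij) (diff a i _) (diff a j _)
  (dot_deviation i Uu) (dot_deviation j Uu) (dot_deviation a Uu)
  (codazzi_pair i j Uu) (codazzi_pair a j Uu) (codazzi_pair a i Uu)).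
- by rewrite eq_sym.
- by rewrite eq_sym.
Qed.

(** If [kap u] is nonzero, the sphere of curvature [kap u] touching the
    hypersurface at [F u] has centre [F u + nu u / kap u].  Its equation in the sense of [hypersphere_eq] is
    normalized by taking [kap u] times the centre as second coefficient. *)
Definition sphere_center u : 'rV[R]_n.+1 := nu u + kap u *: F u.
Definition sphere_power u := kap u * dot (F u) (F u) + 2 * dot (nu u) (F u).

Lemma smooth_sphere_center : smooth_on U sphere_center.
Proof. by apply: smoothD => //; apply: smooth_scale => //; exact: smooth_curvature. Qed.

Lemma smooth_sphere_power : smooth_on U sphere_power.
Proof.
apply: smoothD => //; apply: smoothM => //.
- exact: smooth_curvature.
- exact: smooth_dot.
- exact: smooth_cst.
- exact: smooth_dot.
Qed.

Lemma sphere_normalized u : U u ->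
  dot (sphere_center u) (sphere_center u) - kap u * sphere_power u = 1.
Proof.
move=> Uu; have alg (N X : 'rV[R]_n.+1) k : dot N N = 1 ->
    dot (N + k *: X) (N + k *: X) - k * (k * dot X X + 2 * dot N X) = 1.
  by move=> NN; rewrite !(dotDl, dotDr, dotZl, dotZr) NN (dotC X N); ring.
exact: alg (dot_unit_normal immF Uu).
Qed.

Lemma derive_sphere_center i u : U u ->
  D i sphere_center u = p i u *: (w u + D a kap u *: F u).
Proof.
move=> Uu.
have dk := smooth_differentiable smooth_curvature Uu.
have dF := smooth_differentiable sF Uu.
have dn := smooth_differentiable snu Uu.
have [dkF DkF] := derive_fun_scale (e i) dk dF.
apply: (etrans (derive_fun_add (e i) dn dkF)).
apply: (etrans (f_equal (fun x => _ + x) DkF)).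
have alg (N Y Z W : 'rV[R]_n.+1) (q l l' k : R) : N + k *: Y = q *: W ->
    l = q * l' -> N + (l *: Z + k *: Y) = q *: (W + l' *: Z).
  by move=> NY ->; rewrite addrCA NY addrC scalerDr scalerA.
exact: alg (weingarten i Uu) (derive_curvature i Uu).
Qed.

Lemma derive_sphere_power i u : U u -> D i sphere_power u =
  p i u * (D a kap u * dot (F u) (F u) + 2 * dot (w u) (F u)).
Proof.
move=> Uu.
have dk := smooth_differentiable smooth_curvature Uu.
have dF := smooth_differentiable sF Uu.
have dn := smooth_differentiable snu Uu.
have dFF := differentiable_dot dF dF; have dnF := differentiable_dot dn dF.
have d2 : differentiable (fun=> 2 : R) u by exact: differentiable_cst.
have E1 := derive_fun_mul (e i) dk dFF.
have E2 := derive_fun_mul (e i) d2 dnF.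
have d1 : differentiable (fun v => kap v * dot (F v) (F v)) u.
  exact: (differentiableM dk dFF).
have d3 : differentiable (fun v => 2 * dot (nu v) (F v)) u.
  exact: (differentiableM d2 dnF).
apply: (etrans (derive_fun_add (e i) d1 d3)).
apply: (etrans (f_equal2 +%R E1 E2)).
have W := f_equal (fun x => dot x (F u)) (weingarten i Uu).
rewrite /= dotDl !dotZl in W.
have nF := dot_frame_normal e immF i Uu.
have DF := derive_dot (e i) dF dF; have DN := derive_dot (e i) dn dF.
have alg (x y y' z z' f l l' q k wF t d t' : R) :
    t' = 0 -> x = y + y' -> y' = y -> z = z' + t -> t = 0 ->
    z' + k * y = q * wF -> l = q * l' ->
    l * f + k * x + (t' * d + 2 * z) = q * (l' * f + 2 * wF).
  move=> -> -> -> -> -> E ->; rewrite [RHS]mulrDr (mulrCA q 2) -E; ring.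
apply: (alg _ _ _ _ _ _ _ _ _ _ _ _ _ _ _ DF (dotC _ _) DN _ W (derive_curvature i Uu)).
  exact: derive_cst.
exact: (etrans (dotC _ _) nF).
Qed.

Lemma sphere_incidence u :
  hypersphere_eq (kap u) (sphere_center u) (sphere_power u) (F u) = 0.
Proof.
have alg (N X : 'rV[R]_n.+1) k :
    k * dot X X - 2 * dot (N + k *: X) X + (k * dot X X + 2 * dot N X) = 0.
  by rewrite dotDl dotZl; ring.
exact: alg.
Qed.

End Pivot.

(** * Umbilical points *)

Lemma smooth_subset (R : realType) (V W : normedModType R) (U U' : set V) (f : V -> W) :
  U' `<=` U -> smooth_on U f -> smooth_on U' f.
Proof. by move=> UU sf vs u /UU; exact: sf. Qed.

Lemma immersion_subset (R : realType) n m (U U' : set 'rV[R]_n)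
    (F : 'rV[R]_n -> 'rV[R]_m) :
  U' `<=` U -> immersion_on U F -> immersion_on U' F.
Proof.
move=> UU [sF fF]; split; first exact: smooth_subset UU sF.
by move=> u /UU; exact: fF.
Qed.

Lemma open_positive_neighborhood (R : realType) (V : normedModType R) (U : set V) u
    (f : V -> R) : open U -> U u -> smooth_on U f -> 0 < f u ->
  exists U', [/\ open U', U' u, U' `<=` U & forall v, U' v -> 0 < f v].
Proof.
move=> oU Uu sf fu.
have cf := differentiable_continuous (smooth_differentiable sf Uu).
have nU : nbhs u U by exact: open_nbhs_nbhs.
have nf : \forall v \near u, 0 < f v.
  move/cvgrPdist_lt : cf => /(_ _ fu); apply: filterS => v.
  by rewrite ltr_norml => /andP[_]; rewrite ltrBlDr ltrDl.
have : nbhs u (U `&` [set v | 0 < f v]) by exact: filterI.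
rewrite nbhsE => -[U' [oU' U'u] sub]; exists U'; split=> //.
  by move=> v /sub[].
by move=> v /sub[].
Qed.

Section ShapeOperator.
Variables (R : realType) (n : nat) (U : set 'rV[R]_n).
Variables (F : 'rV[R]_n -> 'rV[R]_n.+1).
Hypotheses (oU : open U) (immF : immersion_on U F).

(** The second fundamental form on arbitrary constant vectors. *)
Definition hessian u (x y : 'rV[R]_n) : R := dot ('D_x ('D_y F) u) (unit_normal F u).

Lemma hessian_linearl u k x x' y : U u ->
  hessian u (k *: x + x') y = k * hessian u x y + hessian u x' y.
Proof.
move=> Uu; have dD := smooth_differentiable (smooth_derive y immF.1) Uu.
have E := derive_linear_dir k x x' dD.
by rewrite -dotZl -dotDl; exact (f_equal (fun z => dot z (unit_normal F u)) E).
Qed.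

Lemma hessianC u x y : U u -> hessian u x y = hessian u y x.
Proof.
move=> Uu; have C := derive_comm_row y x oU immF.1 Uu.
exact (f_equal (fun z => dot z (unit_normal F u)) C).
Qed.

Lemma hessian_linearr u k x y y' : U u ->
  hessian u x (k *: y + y') = k * hessian u x y + hessian u x y'.
Proof.
move=> Uu; apply: (etrans (hessianC x (k *: y + y') Uu)).
apply: (etrans (hessian_linearl k y y' x Uu)).
exact (f_equal2 (fun s t => k * s + t) (hessianC y x Uu) (hessianC y' x Uu)).
Qed.

Lemma shape_operator_scalar u r lam : U u -> 0 < r -> metric F u = r%:M ->
  (forall i j, hessian u (delta_mx 0 i) (delta_mx 0 j) = lam * (i == j)%:R) ->
  shape_operator F u = (lam / r)%:M.
Proof.
move=> Uu r0 mF hl; rewrite /shape_operator mF invmx_scalar mul_mx_scalar.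
have dn := smooth_differentiable (smooth_unit_normal oU immF) Uu.
apply/matrixP => i j; rewrite mxE [X in - X]mxE [RHS]mxE.
have gen (A C : 'M[R]_(n, n.+1)) : (A *m C^T) i j = dot (row i A) (row j C).
  by rewrite mxE; apply: eq_bigr => k _; rewrite !mxE.
have En : row i (jacobian (unit_normal F) u) = 'D_(delta_mx 0 i) (unit_normal F) u.
  by rewrite rowE; exact: (esym (deriveEjacobian _ dn)).
have EF := row_jacobian immF j Uu.
rewrite gen; apply: (etrans (f_equal2 (fun x y => - (r^-1 * dot x y)) En EF)).
have E := dot_derive_normal (delta_mx 0) oU immF i j Uu.
apply: (etrans (f_equal (fun x => - (r^-1 * x)) E)).
apply: (etrans (f_equal (fun x => - (r^-1 * - x)) (hl i j))).
by rewrite mulrN opprK mulrCA mulrA mulr_natr.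
Qed.

End ShapeOperator.

(** * One-parameter families of spheres *)

Section Proportional.
#[local] Opaque derive dot.

Variables (R : realType) (n : nat) (U : set 'rV[R]_n).
Variables (e : 'I_n -> 'rV[R]_n) (a : 'I_n) (p : 'I_n -> 'rV[R]_n -> R).
Hypothesis oU : open U.
Hypothesis on : forall i j, dot (e i) (e j) = (i == j)%:R.
Hypothesis sp : forall i, smooth_on U (p i).

(** The differential of [g] is a multiple of the linear form with coefficients
    [p i]; the factor is [D_a g] for forms with [p a = 1]. *)
Definition proportional (g : 'rV[R]_n -> R) : Prop :=
  smooth_on U g /\ forall i u, U u -> 'D_(e i) g u = p i u * 'D_(e a) g u.

Lemma derive_scalel (f : 'rV[R]_n -> R) (k : R) v u : differentiable f u ->
  differentiable (fun w => k * f w) u /\ 'D_v (fun w => k * f w) u = k * 'D_v f u.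
Proof.
move=> df; have dk : differentiable (fun=> k : R) u by exact: differentiable_cst.
split; first exact: (differentiableM dk df).
apply: (etrans (derive_fun_mul v dk df)).
by rewrite derive_cst mul0r add0r.
Qed.

Lemma derive_combination (f g : 'rV[R]_n -> R) (k l : R) v u :
  differentiable f u -> differentiable g u ->
  'D_v (fun w => k * f w + l * g w) u = k * 'D_v f u + l * 'D_v g u.
Proof.
move=> df dg; have [dkf Dkf] := derive_scalel k v df.
have [dlg Dlg] := derive_scalel l v dg.
exact (etrans (derive_fun_add v dkf dlg) (f_equal2 +%R Dkf Dlg)).
Qed.

Lemma proportional_combination (f g : 'rV[R]_n -> R) (k l : R) :
  proportional f -> proportional g -> proportional (fun u => k * f u + l * g u).
Proof.
move=> [sf pf] [sg pg]; split.
  by apply: smoothD => //; apply: smoothM => //; exact: smooth_cst.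
move=> i u Uu.
have df := smooth_differentiable sf Uu; have dg := smooth_differentiable sg Uu.
have alg (x x' y y' q : R) : x = q * x' -> y = q * y' ->
    k * x + l * y = q * (k * x' + l * y') by move=> -> ->; ring.
have E := alg _ _ _ _ _ (pf i u Uu) (pg i u Uu).
apply: (etrans (derive_combination k l (e i) df dg)); apply: (etrans E).
exact (f_equal (fun x => p i u * x) (esym (derive_combination k l (e a) df dg))).
Qed.

Lemma proportional_derive (f s : 'rV[R]_n -> R) u v : proportional f -> proportional s ->
  U u -> 'D_v f u * 'D_(e a) s u = 'D_v s u * 'D_(e a) f u.
Proof.
move=> [sf pf] [ss ps] Uu.
have expand g : smooth_on U g ->
    (forall i u, U u -> 'D_(e i) g u = p i u * 'D_(e a) g u) ->
    'D_v g u = (\sum_i dot v (e i) * p i u) * 'D_(e a) g u.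
  move=> sg pg; have dg := smooth_differentiable sg Uu.
  apply: (etrans (derive_frame_expansion on v dg)); rewrite big_distrl.
  apply: eq_bigr => i _; apply: (etrans (f_equal (fun x => _ * x) (pg i u Uu))).
  exact: mulrA.
have alg (x x' y y' q : R) : x = q * x' -> y = q * y' -> x * y' = y * x'.
  by move=> -> ->; ring.
exact: alg (expand f sf pf) (expand s ss ps).
Qed.

(** Differentiating [D_i g = p i * D_a g] along [e a] shows that the slope of
    one proportional function with respect to another is again proportional. *)
Lemma proportional_slope (f s : 'rV[R]_n -> R) : proportional f -> proportional s ->
  (forall u, U u -> 'D_(e a) s u != 0) ->
  proportional (fun u => 'D_(e a) f u / 'D_(e a) s u).
Proof.
move=> pf ps s0; have [sf Df] := pf; have [ss Ds] := ps.
have sDf := smooth_derive (e a) sf; have sDs := smooth_derive (e a) ss.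
split; first by apply: smoothM => //; exact: smoothV.
have second g i u : proportional g -> U u -> 'D_(e i) ('D_(e a) g) u =
    'D_(e a) (p i) u * 'D_(e a) g u + p i u * 'D_(e a) ('D_(e a) g) u.
  move=> [sg Dg] Uu; apply: (etrans (derive_comm oU (e a) (e i) sg Uu)).
  have dp := smooth_differentiable (sp i) Uu.
  have dDg := smooth_differentiable (smooth_derive (e a) sg) Uu.
  apply: (etrans _ (derive_fun_mul (e a) dp dDg)).
  by apply: (derive_eq_on oU) Uu => w Uw; exact: Dg.
move=> i u Uu.
have dDf := smooth_differentiable sDf Uu; have dDs := smooth_differentiable sDs Uu.
have quotient v : 'D_v (fun w => 'D_(e a) f w / 'D_(e a) s w) u =
    ('D_v ('D_(e a) f) u * 'D_(e a) s u - 'D_(e a) f u * 'D_v ('D_(e a) s) u)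
      / 'D_(e a) s u ^+ 2.
  have dV := differentiableV dDs (s0 u Uu).
  apply: (etrans (derive_fun_mul v dDf dV)).
  have DV : 'D_v (fun w => ('D_(e a) s w)^-1) u =
      - ('D_(e a) s u) ^- 2 *: 'D_v ('D_(e a) s) u.
    exact (@deriveV R _ ('D_(e a) s) u v (s0 u Uu) (diff_derivable dDs)).
  apply: (etrans (f_equal (fun x =>
    'D_v ('D_(e a) f) u * ('D_(e a) s u)^-1 + 'D_(e a) f u * x) DV)).
  have alg (x y z t : R) : t != 0 -> x * t^-1 + y * (- t ^- 2 *: z) = (x * t - y * z) / t ^+ 2.
    by move=> t0; rewrite /GRing.scale /=; field.
  exact: alg (s0 u Uu).
have alg (x x' y y' ya xa q q' t : R) : x' = q' * x + q * xa -> y' = q' * y + q * ya ->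
    (x' * y - x * y') / t = q * ((xa * y - x * ya) / t).
  by move=> -> ->; ring.
apply: (etrans (quotient (e i))).
apply: (etrans (alg _ _ _ _ _ _ _ _ _ (second f i u pf Uu) (second s i u ps Uu))).
exact (f_equal (fun x => p i u * x) (esym (quotient (e a)))).
Qed.

Lemma proportional_subset (U' : set 'rV[R]_n) g : U' `<=` U -> proportional g ->
  smooth_on U' g /\ forall i u, U' u -> 'D_(e i) g u = p i u * 'D_(e a) g u.
Proof.
move=> UU [sg pg]; split; first exact: smooth_subset UU sg.
by move=> i u /UU; exact: pg.
Qed.

End Proportional.

Section Envelope.
#[local] Opaque derive dot unit_normal second_form.

Lemma derive_line (R : realType) (V W : normedModType R) (f : V -> W) x v (t : R) :
  differentiable f (t *: v + x) ->
  'D_1 (fun s : R => f (s *: v + x)) t = 'D_v f (t *: v + x).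
Proof. by move=> /is_derive_line[_ ->]. Qed.

(** The hypotheses describe spheres with coefficients [kap], [B], [q] which pass
    through the points [F u] and whose derivatives are [p i] times the triple
    [k', w + k' * F, k' * |F|^2 + 2 * <w, F>] with [k' := D_a kap].  This triple
    has Lorentzian square [|w|^2], and is orthogonal to the point [F u], which
    is the tangency of the sphere. *)
Lemma canal_of_sphere_pencil (R : realType) n (U : set 'rV[R]_n) (u0 : 'rV[R]_n)
    (F B w : 'rV[R]_n -> 'rV[R]_n.+1) (kap q : 'rV[R]_n -> R)
    (p : 'I_n -> 'rV[R]_n -> R) (e : 'I_n -> 'rV[R]_n) (a : 'I_n) :
  open U -> U u0 -> (forall i j, dot (e i) (e j) = (i == j)%:R) ->
  (forall i, smooth_on U (p i)) -> smooth_on U kap -> smooth_on U B -> smooth_on U q ->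
  (forall i u, U u -> 'D_(e i) kap u = p i u * 'D_(e a) kap u) ->
  (forall i u, U u -> 'D_(e i) B u = p i u *: (w u + 'D_(e a) kap u *: F u)) ->
  (forall i u, U u -> 'D_(e i) q u =
     p i u * ('D_(e a) kap u * dot (F u) (F u) + 2 * dot (w u) (F u))) ->
  (forall u, U u -> p a u = 1) ->
  (forall u, U u -> dot (B u) (B u) - kap u * q u = 1) ->
  (forall u, U u -> hypersphere_eq (kap u) (B u) (q u) (F u) = 0) ->
  (forall u, U u -> 0 < dot (w u) (w u)) ->
  exists C, canal_hypersurface C /\ \forall u \near u0, C (F u).
Proof.
move=> oU Uu0 on sp sk sB sq Dk DB Dq pa norm incid ww.
have DBa u : U u -> 'D_(e a) B u = w u + 'D_(e a) kap u *: F u.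
  move=> Uu; apply: (etrans (DB a u Uu)).
  exact (etrans (f_equal (fun x => x *: _) (pa u Uu)) (scale1r _)).
have Dqa u : U u -> 'D_(e a) q u = 'D_(e a) kap u * dot (F u) (F u) + 2 * dot (w u) (F u).
  move=> Uu; apply: (etrans (Dq a u Uu)).
  exact (etrans (f_equal (fun x => x * _) (pa u Uu)) (mul1r _)).
have dB u : U u -> differentiable B u by exact: smooth_differentiable sB.
have dk u : U u -> differentiable kap u by exact: smooth_differentiable sk.
have dq u : U u -> differentiable q u by exact: smooth_differentiable sq.
have DdotB x v u : U u -> differentiable (fun z => dot x (B z)) u /\
    'D_v (fun z => dot x (B z)) u = dot x ('D_v B u).
  move=> Uu; have dx : differentiable (fun=> x) u by exact: differentiable_cst.
  split; first exact: (differentiable_dot dx (dB u Uu)).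
  apply: (etrans (derive_dot v dx (dB u Uu))).
  by rewrite derive_cst dot0l add0r.
have pk : proportional U e a p kap by split.
have pq : proportional U e a p q.
  by split=> // i u Uu; rewrite Dqa//; exact: Dq.
have pB x : proportional U e a p (fun z => dot x (B z)).
  split; first by apply: smooth_dot => //; exact: smooth_cst.
  move=> i u Uu; have [_ Ei] := DdotB x (e i) u Uu; have [_ Ea] := DdotB x (e a) u Uu.
  apply: (etrans Ei); apply: (etrans (f_equal (dot x) (DB i u Uu))); rewrite dotZr.
  exact (f_equal (fun y => p i u * y) (esym (etrans Ea (f_equal (dot x) (DBa u Uu))))).
pose Psi x u := hypersphere_eq (kap u) (B u) (q u) x.
have PsiE x : Psi x = fun u => dot x x * kap u + 1 * (- 2 * dot x (B u) + 1 * q u).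
  by apply/funext => u; rewrite /Psi /hypersphere_eq (dotC x (B u)); ring.
have pPsi x : proportional U e a p (Psi x).
  rewrite PsiE; apply: (proportional_combination oU) => //.
  exact: (proportional_combination oU).
(* A linear combination of the coefficients with derivative [|w u0|^2] along
   [e a] at [u0]. *)
pose s u := 1 * dot (w u0) (B u) + - dot (w u0) (F u0) * kap u.
have ps : proportional U e a p s by exact: (proportional_combination oU).
have Ds0 : 0 < 'D_(e a) s u0.
  have [d1 D1] := DdotB (w u0) (e a) u0 Uu0.
  have E := derive_combination 1 (- dot (w u0) (F u0)) (e a) d1 (dk u0 Uu0).
  suff -> : 'D_(e a) s u0 = dot (w u0) (w u0) by exact: ww.
  apply: (etrans E); apply: (etrans (f_equal (fun y => 1 * y + _) D1)).
  apply: (etrans (f_equal (fun y => 1 * dot (w u0) y + _) (DBa u0 Uu0))).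
  by rewrite dotDr dotZr; ring.
have DPsi x u v : U u -> 'D_v (Psi x) u =
    dot x x * 'D_v kap u - 2 * dot x ('D_v B u) + 'D_v q u.
  move=> Uu; rewrite PsiE; have [d1 D1] := DdotB x v u Uu.
  have [d2 D2] := derive_scalel (- 2) v d1; have [d3 D3] := derive_scalel 1 v (dq u Uu).
  have E1 := derive_combination (- 2) 1 v d1 (dq u Uu).
  have E2 := derive_combination (dot x x) 1 v (dk u Uu) (differentiableD d2 d3).
  apply: (etrans E2); apply: (etrans (f_equal (fun y => _ + 1 * y) E1)).
  apply: (etrans (f_equal (fun y => _ + 1 * (- 2 * y + _)) D1)); ring.
have tangent u : U u -> 'D_(e a) (Psi (F u)) u = 0.
  move=> Uu; apply: (etrans (DPsi (F u) u (e a) Uu)).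
  apply: (etrans (f_equal2 (fun y z => _ - 2 * dot (F u) y + z) (DBa u Uu) (Dqa u Uu))).
  by rewrite dotDr dotZr (dotC (F u) (w u)); ring.
have [U2 [oU2 U2u0 U2U Ds]] := open_positive_neighborhood oU Uu0 (smooth_derive (e a) ps.1) Ds0.
have sp2 i : smooth_on U2 (p i) by exact: smooth_subset U2U (sp i).
have ps2 : proportional U2 e a p s := proportional_subset U2U ps.
have pPsi2 x : proportional U2 e a p (Psi x) := proportional_subset U2U (pPsi x).
have Ds_neq0 u : U2 u -> 'D_(e a) s u != 0 by move=> /Ds/lt0r_neq0.
pose l (t : R) := t *: e a + u0.
have [eps eps0 lU2] : exists2 eps : R, 0 < eps & forall t, `|t| < eps -> U2 (l t).
  have /nbhs_ballP[r /= r0 Br] : nbhs u0 U2 by exact: open_nbhs_nbhs.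
  have ea0 : 0 < `|e a| + 1 by rewrite ltr_wpDl.
  exists (r / (`|e a| + 1)); first exact: divr_gt0.
  move=> t tr; apply: Br; rewrite -ball_normE /= /l opprD addrCA subrr addr0 normrN normrZ.
  apply: (@le_lt_trans _ _ (`|t| * (`|e a| + 1))); first by rewrite ler_wpM2l// lerDl.
  by rewrite -ltr_pdivlMr.
pose I : set R := [set t | `|t| < eps].
have oI : open I.
  have -> : I = ball (0 : R) eps.
    by apply/seteqP; split=> t; rewrite /I -ball_normE /= sub0r normrN.
  exact: ball_open.
have lU t : I t -> U (l t) by move=> /lU2/U2U.
pose C := envelope I (fun t => hypersphere_eq (kap (l t)) (B (l t)) (q (l t))).
exists C; split.
  exists I, (fun t => kap (l t)), (fun t => B (l t)), (fun t => q (l t)); split=> //.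
  have Dkl t : I t -> 'D_1 (fun t => kap (l t)) t = 'D_(e a) kap (l t).
    by move=> It; exact: derive_line (dk _ (lU t It)).
  have DBl t : I t -> 'D_1 (fun t => B (l t)) t = 'D_(e a) B (l t).
    by move=> It; exact: derive_line (dB _ (lU t It)).
  have Dql t : I t -> 'D_1 (fun t => q (l t)) t = 'D_(e a) q (l t).
    by move=> It; exact: derive_line (dq _ (lU t It)).
  split.
  - split=> // x y Ix Iy z /andP[xz zy]; move: Ix Iy; rewrite /I /= !ltr_norml.
    move=> /andP[x1 x2] /andP[y1 y2].
    by rewrite (lt_le_trans x1 xz) (le_lt_trans zy y2).
  - split; [exact: (smooth_line oU oI lU sk)| |exact: (smooth_line oU oI lU sq)].
    apply/(smooth_rowP oI) => j.
    exact: (smooth_line oU oI lU ((smooth_rowP oU B).1 sB j)).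
  - by move=> t It; exact: norm (lU t It).
  - move=> t It; rewrite (DBl t It) (Dkl t It) (Dql t It).
    rewrite (DBa _ (lU t It)) (Dqa _ (lU t It)).
    have alg (W X : 'rV[R]_n.+1) k :
        dot (W + k *: X) (W + k *: X) - k * (k * dot X X + 2 * dot W X) = dot W W.
      by rewrite !(dotDl, dotDr, dotZl, dotZr) (dotC X W); ring.
    by rewrite alg; exact: ww (lU t It).
have trans := level_transport oU2 U2u0 ps2.1 Ds0 eps0.
have nU2 : \forall u \near u0, U2 u by exact: open_nbhs_nbhs.
apply: filterS2 trans nU2 => u [t It transport] U2u.
have const g : proportional U2 e a p g -> g u = g (l t).
  move=> pg; apply: transport => [x U2x|x v U2x].
    exact: smooth_differentiable pg.1 U2x.
  exact: (proportional_derive on v pg ps2 U2x).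
exists t; split=> //.
  by have := const _ (pPsi2 (F u)); rewrite {1}/Psi (incid u (U2U u U2u)) => /esym.
have sl := const _ (proportional_slope oU2 sp2 (pPsi2 (F u)) ps2 Ds_neq0).
have DPl : 'D_1 (fun t => Psi (F u) (l t)) t = 'D_(e a) (Psi (F u)) (l t).
  apply: derive_line; exact: smooth_differentiable (pPsi (F u)).1 (lU t It).
apply: (etrans DPl).
have T := tangent u (U2U u U2u).
have : 'D_(e a) (Psi (F u)) (l t) / 'D_(e a) s (l t) = 0.
  apply: (etrans (esym sl)); exact (etrans (f_equal (fun y => y / _) T) (mul0r _)).
move=> /eqP; rewrite mulf_eq0 invr_eq0 (negPf (Ds_neq0 _ (lU2 t It))) orbF => /eqP.
exact.
Qed.

(** The family is that of the curvature spheres. *)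
Lemma canal_of_pivot (R : realType) n (U : set 'rV[R]_n) (u0 : 'rV[R]_n)
    (F : 'rV[R]_n -> 'rV[R]_n.+1) (rho : 'rV[R]_n -> R) (e : 'I_n -> 'rV[R]_n)
    (a b c : 'I_n) :
  (4 <= n)%N -> open U -> U u0 -> immersion_on U F -> smooth_on U rho ->
  (forall u, U u -> 0 < rho u) -> (forall u, U u -> metric F u = (rho u)%:M) ->
  (forall i j, dot (e i) (e j) = (i == j)%:R) ->
  a != b -> c != a -> c != b ->
  (forall u, U u -> second_form F e a b u != 0) ->
  exists C, canal_hypersurface C /\ \forall u \near u0, C (F u).
Proof.
move=> n4 oU Uu0 immF srho rho0 mF on ab ca cb hab.
pose kap := curvature F rho e a b c; pose w := deviation F rho e a b c.
pose p := deviation_ratio F e a b c.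
pose B := sphere_center F rho e a b c; pose q := sphere_power F rho e a b c.
have sF := immF.1.
have sp i : smooth_on U (p i) := smooth_deviation_ratio oU immF c hab i.
have sk : smooth_on U kap := smooth_curvature oU immF srho rho0 c hab.
have sB : smooth_on U B := smooth_sphere_center oU immF srho rho0 c hab.
have sq : smooth_on U q := smooth_sphere_power oU immF srho rho0 c hab.
have Dk i u : U u -> 'D_(e i) kap u = p i u * 'D_(e a) kap u.
  exact: (derive_curvature oU immF srho rho0 mF on n4 ab ca cb hab).
have DB i u : U u -> 'D_(e i) B u = p i u *: (w u + 'D_(e a) kap u *: F u).
  exact: (derive_sphere_center oU immF srho rho0 mF on n4 ab ca cb hab).
have Dq i u : U u -> 'D_(e i) q u =
    p i u * ('D_(e a) kap u * dot (F u) (F u) + 2 * dot (w u) (F u)).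
  exact: (derive_sphere_power oU immF srho rho0 mF on n4 ab ca cb hab).
have pa u : U u -> p a u = 1 by exact: (deviation_ratio_pivot c ab hab).
apply: (canal_of_sphere_pencil oU Uu0 on sp sk sB sq Dk DB Dq) => u Uu.
- exact: (deviation_ratio_pivot c ab hab).
- exact: (sphere_normalized rho e immF a b c Uu).
- exact: sphere_incidence.
- by apply: dot_gt0; exact: (deviation_neq0 oU immF rho0 mF on c ab hab Uu).
Qed.

End Envelope.

(** * The theorem *)

#[local] Opaque derive dot unit_normal.

Theorem theorem5p3 (R : realType) (n : nat) (M : topologicalType)
    (f : M -> 'rV[R]_n.+1) :
  (4 <= n)%N ->
  hypersurface f ->
  conformally_flat f ->
  (forall p : M, ~ umbilical f p) ->
  forall p : M, exists W : set M, exists C : set 'rV[R]_n.+1,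
    [/\ nbhs p W, canal_hypersurface C & f @` W `<=` C].
Proof.
move=> n4 _ conf numb p.
have [U [x [rho [lp [u0 Uu0 xu0] srho rhoU]]]] := conf p.
have [oU _ _ openx immF] := lp.
set F := f \o x in immF rhoU.
have nscal : ~ (exists lam, forall i j,
    hessian F u0 (delta_mx 0 i) (delta_mx 0 j) = lam * (i == j)%:R).
  move=> [lam hl]; apply: (numb p); exists U, x, u0; split=> //.
  have [r0 mF] := rhoU u0 Uu0.
  by exists (lam / rho u0); exact: (shape_operator_scalar oU immF Uu0 r0 mF hl).
have [e [a [b [on ab hab0]]]] := off_diagonal_frame
  (fun v v' w k => hessian_linearl immF k v v' w Uu0)
  (fun v w w' k => hessian_linearr oU immF k v w w' Uu0) nscal.
have [c [ca cb _]] := ord_avoid3 a b b n4.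
have sh := smooth_second_form e oU immF a b.
have h0 : 0 < second_form F e a b u0 * second_form F e a b u0.
  by rewrite -expr2 exprn_even_gt0//=.
have [U' [oU' U'u0 UU hab]] := open_positive_neighborhood oU Uu0 (smoothM oU sh sh) h0.
have hab' u : U' u -> second_form F e a b u != 0.
  by move=> /hab; apply: contraTneq => ->; rewrite mul0r ltxx.
have [C [canalC nC]] := canal_of_pivot n4 oU' U'u0 (immersion_subset UU immF)
  (smooth_subset UU srho) (fun u U'u => (rhoU u (UU u U'u)).1)
  (fun u U'u => (rhoU u (UU u U'u)).2) on ab ca cb hab'.
pose V := interior (U `&` [set u | C (F u)]).
have Vu0 : V u0 by exact: (filterI (open_nbhs_nbhs (conj oU Uu0)) nC).
have oV : open V by exact: open_interior.
have sub : V `<=` U `&` [set u | C (F u)] by exact: interior_subset.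
exists (x @` V), C; split=> //.
  have VU : V `<=` U by move=> u /sub[].
  apply: open_nbhs_nbhs; split; first exact: openx V VU oV.
  by exists u0.
by move=> _ [_ [u Vu <-] <-]; have [_] := sub u Vu.
Qed.
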